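(* Let $h_1,h_2$ be smooth real-valued functions on $\mathbb{S}^2$ and let $(u,\psi)$ be a smooth solution of $$\begin{cases} -\Delta u = h_1 e^{2u} - 1 + h_2 e^{u}|\psi|^2, & \text{on } \mathbb{S}^2,\\ D\psi = h_2 e^{u}\psi, & \text{on } \mathbb{S}^2.\end{cases}$$ Then, for $i=1,2,3$, $$\int_{\mathbb{S}^2}\langle\nabla h_1,\nabla x_i\rangle e^{2u}\,dv + 2\int_{\mathbb{S}^2}\langle\nabla h_2,\nabla x_i\rangle e^{u}|\psi|^2\,dv = 0 .$$
   Context: $\mathbb{S}^2$ is the unit sphere in $\mathbb{R}^3$ with its standard round metric $g_0$ and its unique spin structure; $dv$ is the volume form of $g_0$, $\Delta$ the Laplace–Beltrami operator (nonpositive), and $\nabla$, $\langle\cdot,\cdot\rangle$, $|\cdot|$ are taken with respect to $g_0$. $\mathcal{S}\mathbb{S}^2$ is the spinor bundle, and $D$ is the Dirac operator $D\psi=\sum_{\alpha=1}^2 e_\alpha\cdot\nabla_{e_\alpha}\psi$ ($\{e_\alpha\}$ a local orthonormal frame, with Clifford relation $X\cdot Y+Y\cdot X=-2g_0(X,Y)$). $u$ is a real-valued function and $\psi$ a spinor (section of $\mathcal{S}\mathbb{S}^2$). $x_1,x_2,x_3$ are the coordinate functions of the standard embedding $\mathbb{S}^2\subset\mathbb{R}^3$. *)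

(* Defs.v *)
From Stdlib Require Import Reals Lra.
From Coquelicot Require Import Coquelicot.
Open Scope R_scope.

(* The Coquelicot norm on a product is sqrt (norm fst ^ 2 + norm snd ^ 2), so
   [norm] below is the Euclidean norm of R^3 and of C^2 = R^4. *)
Definition V3 : NormedModule R_AbsRing :=
  prod_NormedModule R_AbsRing
    (prod_NormedModule R_AbsRing R_NormedModule R_NormedModule) R_NormedModule.
Definition V4 : NormedModule R_AbsRing :=
  prod_NormedModule R_AbsRing C_R_NormedModule C_R_NormedModule.

Definition unit_sphere {V : NormedModule R_AbsRing} (x : V) : Prop := norm x = 1.

(* A function on a unit sphere is represented by a function on the ambient
   space of which only the values on the sphere are ever used. [ext f] is its
   extension to the complement of 0 that is constant along rays. *)
Definition ext {V : NormedModule R_AbsRing} {T : Type} (f : V -> T) (x : V) : T :=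
  f (scal (/ norm x) x).

Definition dirderiv {V : NormedModule R_AbsRing} (v : V) (f : V -> R) (x : V) : R :=
  Derive (fun t => f (plus x (scal t v))) 0.

(* On an open subset U of a finite-dimensional space, this is the usual class
   C^k. *)
Fixpoint of_class_C {V : NormedModule R_AbsRing} (k : nat) (U : V -> Prop)
    (f : V -> R) : Prop :=
  match k with
  | O => forall x, U x -> continuous f x
  | S k => (forall x, U x -> ex_filterdiff f (locally x)) /\
           forall v, of_class_C k U (dirderiv v f)
  end.

(* The radial retraction of V \ {0} onto the sphere is smooth, so this is
   smoothness for the submanifold structure of the unit sphere. *)
Definition smooth_on_sphere {V : NormedModule R_AbsRing} (f : V -> R) : Prop :=
  forall k, of_class_C k (fun x => x <> zero) (ext f).

Definition dot (v w : V3) : R :=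
  fst (fst v) * fst (fst w) + snd (fst v) * snd (fst w) + snd v * snd w.

Definition coord (i : nat) (p : V3) : R :=
  match i with
  | 1%nat => fst (fst p)
  | 2%nat => snd (fst p)
  | 3%nat => snd p
  | _ => 0
  end.

Definition basis (i : nat) : V3 :=
  match i with
  | 1%nat => ((1, 0), 0)
  | 2%nat => ((0, 1), 0)
  | 3%nat => ((0, 0), 1)
  | _ => zero
  end.

Definition partial (i : nat) (f : V3 -> R) : V3 -> R := dirderiv (basis i) (ext f).

(* [ext f] has no radial derivative, so its Euclidean gradient at a point of
   the sphere is tangent: it is the gradient of f for the round metric. *)
Definition grad (f : V3 -> R) (p : V3) : V3 :=
  ((partial 1 f p, partial 2 f p), partial 3 f p).

(* For a tangent field X, the trace of the Euclidean derivative of [ext X] has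
   no radial contribution, and equals the sum over an orthonormal tangent frame
   of <nabla_{e_a} X, e_a>, where nabla is the tangential part of the
   Euclidean derivative (the Levi-Civita connection). *)
Definition div (X : V3 -> V3) (p : V3) : R :=
  partial 1 (fun q => coord 1 (X q)) p + partial 2 (fun q => coord 2 (X q)) p
  + partial 3 (fun q => coord 3 (X q)) p.

Definition laplace (f : V3 -> R) : V3 -> R := div (grad f).

(* dv = sin(theta) dtheta dphi in spherical coordinates. *)
Definition sphere_integral (f : V3 -> R) : R :=
  RInt (fun phi =>
    RInt (fun theta =>
      f ((sin theta * cos phi, sin theta * sin phi), cos theta) * sin theta)
      0 PI) 0 (2 * PI).

(* The unit sphere of C^2 is identified with SU(2), the pair (a, b) standing
   for the matrix g with first column (a, b) and second column
   (- conj b, conj a); [su2_mul] is the matrix product. *)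
Definition su2_mul (g h : V4) : V4 :=
  let (a, b) := g in let (m, n) := h in
  ((a * m - Cconj b * n)%C, (b * m + Cconj a * n)%C).

(* With s1, s2, s3 the Pauli matrices and v in R^3 identified with
   v1 s1 + v2 s2 + v3 s3, these are g s3 g^*, g s1 g^* and g s2 g^*. The map
   g |-> (frame1 g, frame2 g), an oriented orthonormal frame at [base g], is
   the double cover SU(2) -> SO(3), SO(3) being the oriented orthonormal frame
   bundle of the sphere. This is the spin structure; its structure group
   Spin(2) is the group of the [spin2 w] = diag(w, conj w). *)
Definition vec_of (z : C) (r : R) : V3 := ((fst z, snd z), r).

Definition base (g : V4) : V3 :=
  let (a, b) := g in vec_of (2 * Cconj a * b)%C (Cmod a ^ 2 - Cmod b ^ 2).
Definition frame1 (g : V4) : V3 :=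
  let (a, b) := g in
  vec_of (Cconj a * Cconj a - b * b)%C (- 2 * fst (a * b)%C).
Definition frame2 (g : V4) : V3 :=
  let (a, b) := g in
  vec_of (Ci * (Cconj a * Cconj a + b * b))%C (- 2 * snd (a * b)%C).

Definition spin2 (w : C) : V4 := (w, RtoC 0).

Definition spinor_space : Type := (C * C)%type.

Definition gamma1 (z : spinor_space) : spinor_space :=
  ((Ci * snd z)%C, (Ci * fst z)%C).
Definition gamma2 (z : spinor_space) : spinor_space :=
  (snd z, (- fst z)%C).

Definition spinor_add (z z' : spinor_space) : spinor_space :=
  ((fst z + fst z')%C, (snd z + snd z')%C).
Definition spinor_scal (r : R) (z : spinor_space) : spinor_space :=
  ((RtoC r * fst z)%C, (RtoC r * snd z)%C).
Definition spinor_norm2 (z : spinor_space) : R := Cmod (fst z) ^ 2 + Cmod (snd z) ^ 2.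

(* Spin representation. For w = exp (- i t / 2), [spin2 w] is the lift of the
   rotation of the frame by the angle t, and this is
   cos (t / 2) + sin (t / 2) gamma1 gamma2. *)
Definition spin_rep (w : C) (z : spinor_space) : spinor_space :=
  ((w * fst z)%C, (Cconj w * snd z)%C).

(* The spinor bundle is associated to the spin structure by [spin_rep], so its
   sections are the equivariant maps psi from SU(2) to C^2:
   psi (g h) = rho(h)^-1 psi(g). The vector psi g is the coordinate vector, in
   the spin frame g, of the spinor at the point [base g]. *)
Definition equivariant (psi : V4 -> spinor_space) : Prop :=
  forall (g : V4) (w : C), unit_sphere g -> Cmod w = 1 ->
    psi (su2_mul g (spin2 w)) = spin_rep (Cconj w) (psi g).

Definition smooth_spinor (psi : V4 -> spinor_space) : Prop :=
  equivariant psi /\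
  smooth_on_sphere (fun g => fst (fst (psi g))) /\
  smooth_on_sphere (fun g => snd (fst (psi g))) /\
  smooth_on_sphere (fun g => fst (snd (psi g))) /\
  smooth_on_sphere (fun g => snd (snd (psi g))).

(* For |e| = 1, t |-> g * transport e t is the lift of the Levi-Civita parallel
   transport of the frame of g along the unit-speed geodesic leaving [base g]
   in the direction Re(e) frame1 g + Im(e) frame2 g: see [base_transport],
   [frame_transport_1] and [frame_transport_2]. *)
Definition transport (e : C) (t : R) : V4 :=
  (RtoC (cos (t / 2)), (RtoC (sin (t / 2)) * e)%C).

Definition Cderive (f : R -> C) (t : R) : C :=
  (Derive (fun s => fst (f s)) t, Derive (fun s => snd (f s)) t).

(* The spin connection: differentiation of the coordinates of psi in a parallel
   spin frame. *)
Definition nabla (e : C) (psi : V4 -> spinor_space) (g : V4) : spinor_space :=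
  (Cderive (fun t => fst (psi (su2_mul g (transport e t)))) 0,
   Cderive (fun t => snd (psi (su2_mul g (transport e t)))) 0).

(* The sum over a = 1, 2 of e_a . nabla_{e_a} psi, in the frame e_a = frame_a g. *)
Definition dirac (psi : V4 -> spinor_space) (g : V4) : spinor_space :=
  spinor_add (gamma1 (nabla (RtoC 1) psi g)) (gamma2 (nabla Ci psi g)).

(* A spin frame above p (p on the sphere). *)
Definition spin_frame_above (p : V3) : V4 :=
  let s := sqrt ((1 + coord 3 p) / 2) in
  if Req_EM_T s 0 then (RtoC 0, RtoC 1)
  else (RtoC s, (coord 1 p / (2 * s), coord 2 p / (2 * s))).

(* |psi|^2 as a function on the sphere; independent of the choice of the spin
   frame by [base_fiber] and [equivariant_norm2]. *)
Definition spinor_norm2_at (psi : V4 -> spinor_space) (p : V3) : R :=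
  spinor_norm2 (psi (spin_frame_above p)).

Lemma unit_V3 (p : V3) : unit_sphere p <-> dot p p = 1.
Proof.
destruct p as [[x y] z]; unfold unit_sphere, dot.
change (norm _) with (sqrt (sqrt (Rabs x ^ 2 + Rabs y ^ 2) ^ 2 + Rabs z ^ 2)); simpl fst; simpl snd.
rewrite pow2_sqrt, !pow2_abs by (rewrite !pow2_abs; nra).
replace (x ^ 2 + y ^ 2 + z ^ 2) with (x * x + y * y + z * z) by ring.
split; intros H.
- rewrite <- (sqrt_sqrt (x * x + y * y + z * z)) by nra; rewrite H; ring.
- now rewrite H, sqrt_1.
Qed.

Lemma Cmod_sqr (z : C) : Cmod z ^ 2 = fst z ^ 2 + snd z ^ 2.
Proof. unfold Cmod; rewrite pow2_sqrt; nra. Qed.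

Lemma unit_V4 (a b : C) :
  @unit_sphere V4 (a, b) <-> fst a ^ 2 + snd a ^ 2 + (fst b ^ 2 + snd b ^ 2) = 1.
Proof.
destruct a as [a1 a2], b as [b1 b2]; unfold unit_sphere.
change (norm _) with
  (sqrt (sqrt (Rabs a1 ^ 2 + Rabs a2 ^ 2) ^ 2 + sqrt (Rabs b1 ^ 2 + Rabs b2 ^ 2) ^ 2)).
rewrite !pow2_sqrt, !pow2_abs by (rewrite !pow2_abs; nra); simpl fst; simpl snd.
split; intros H.
- rewrite <- (sqrt_sqrt (_ + _)) by nra; rewrite H; ring.
- now rewrite H, sqrt_1.
Qed.

Ltac su2_unfold :=
  unfold equivariant, su2_mul, spin2, spin_rep, transport, base, frame1, frame2,
    vec_of, dot, gamma1, gamma2, spinor_add, spinor_scal, spinor_norm2,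
    Cminus, Ci, Cconj, Cmult, Cplus, Copp, RtoC in *;
  rewrite ?Cmod_sqr in *;
  cbn [fst snd] in *.

Ltac pair_ring :=
  repeat apply injective_projections;
  cbn; unfold plus, scal; cbn; unfold mult, plus, scal; cbn; ring.

Lemma frame_orthonormal (g : V4) : unit_sphere g ->
  dot (base g) (base g) = 1 /\ dot (frame1 g) (frame1 g) = 1 /\
  dot (frame2 g) (frame2 g) = 1 /\ dot (base g) (frame1 g) = 0 /\
  dot (base g) (frame2 g) = 0 /\ dot (frame1 g) (frame2 g) = 0.
Proof.
destruct g as [[a1 a2] [b1 b2]]; intros H; apply unit_V4 in H; su2_unfold.
assert (H2 : (a1 ^ 2 + a2 ^ 2 + (b1 ^ 2 + b2 ^ 2)) ^ 2 = 1) by (rewrite H; ring).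
repeat split; first [ring | refine (eq_trans _ H2); ring].
Qed.

Lemma scale_eq (r : R) (v w : V3) : 1 = r -> v = scal r w -> v = w.
Proof. intros <- ->; exact (@scal_one R_AbsRing V3 w). Qed.

Lemma half_angle t :
  cos t = cos (t / 2) ^ 2 - sin (t / 2) ^ 2 /\ sin t = 2 * sin (t / 2) * cos (t / 2) /\
  1 = cos (t / 2) ^ 2 + sin (t / 2) ^ 2.
Proof.
assert (E : t = 2 * (t / 2)) by field.
repeat split.
- rewrite E at 1; rewrite cos_2a; ring.
- rewrite E at 1; apply sin_2a.
- generalize (sin2_cos2 (t / 2)); unfold Rsqr; nra.
Qed.

Definition tangent (g : V4) (e : C) : V3 :=
  plus (scal (fst e) (frame1 g)) (scal (snd e) (frame2 g)).

Lemma base_transport (g : V4) (e : C) (t : R) : Cmod e = 1 ->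
  base (su2_mul g (transport e t))
  = plus (scal (cos t) (base g)) (scal (sin t) (tangent g e)).
Proof.
destruct g as [[a1 a2] [b1 b2]], e as [x y]; intros He.
assert (Hxy : x ^ 2 + y ^ 2 = 1).
{ generalize (Cmod_sqr (x, y)); rewrite He; cbn [fst snd]; intros; lra. }
destruct (half_angle t) as (Hc & Hs & _).
replace (cos t) with (cos (t / 2) ^ 2 - (x ^ 2 + y ^ 2) * sin (t / 2) ^ 2)
  by (rewrite Hxy, Hc; ring).
rewrite Hs; unfold tangent; su2_unfold.
generalize (cos (t / 2)) (sin (t / 2)); intros c s.
pair_ring.
Qed.

(* Along the geodesic in direction frame1, frame1 becomes the velocity and
   frame2 is constant in R^3; the roles are exchanged in direction frame2. *)
Lemma frame_transport_1 (g : V4) (t : R) :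
  frame1 (su2_mul g (transport (RtoC 1) t))
  = plus (scal (- sin t) (base g)) (scal (cos t) (frame1 g)) /\
  frame2 (su2_mul g (transport (RtoC 1) t)) = frame2 g.
Proof.
destruct g as [[a1 a2] [b1 b2]].
destruct (half_angle t) as (Hc & Hs & H1).
rewrite Hc, Hs.
split; [|apply (scale_eq _ _ _ H1)];
su2_unfold; generalize (cos (t / 2)) (sin (t / 2)); intros c s; pair_ring.
Qed.

Lemma frame_transport_2 (g : V4) (t : R) :
  frame1 (su2_mul g (transport Ci t)) = frame1 g /\
  frame2 (su2_mul g (transport Ci t))
  = plus (scal (- sin t) (base g)) (scal (cos t) (frame2 g)).
Proof.
destruct g as [[a1 a2] [b1 b2]].
destruct (half_angle t) as (Hc & Hs & H1).
rewrite Hc, Hs.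
split; [apply (scale_eq _ _ _ H1)|];
su2_unfold; generalize (cos (t / 2)) (sin (t / 2)); intros c s; pair_ring.
Qed.

Lemma clifford_relations (z : spinor_space) :
  gamma1 (gamma1 z) = spinor_scal (-1) z /\ gamma2 (gamma2 z) = spinor_scal (-1) z /\
  spinor_add (gamma1 (gamma2 z)) (gamma2 (gamma1 z)) = spinor_scal 0 z.
Proof.
destruct z as [[p q] [r s]]; su2_unfold; repeat match goal with |- _ /\ _ => split end;
  pair_ring.
Qed.

(* Spin(2) rotates the frame, and [spin_rep] intertwines Clifford
   multiplication accordingly. *)
Lemma spin2_frame (g : V4) (w : C) : Cmod w = 1 ->
  base (su2_mul g (spin2 w)) = base g /\
  frame1 (su2_mul g (spin2 w)) = tangent g (Cconj w * Cconj w)%C /\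
  frame2 (su2_mul g (spin2 w)) = tangent g (Ci * (Cconj w * Cconj w))%C.
Proof.
destruct g as [[a1 a2] [b1 b2]], w as [x y]; intros Hw.
assert (Hxy : 1 = x ^ 2 + y ^ 2).
{ generalize (Cmod_sqr (x, y)); rewrite Hw; cbn [fst snd]; intros; lra. }
split; [apply (scale_eq _ _ _ Hxy)|split]; unfold tangent; su2_unfold; pair_ring.
Qed.

Lemma spin_rep_clifford (w : C) (z : spinor_space) :
  let v := (Cconj w * Cconj w)%C in
  spin_rep w (gamma1 (spin_rep (Cconj w) z))
  = spinor_add (spinor_scal (fst v) (gamma1 z)) (spinor_scal (snd v) (gamma2 z)) /\
  spin_rep w (gamma2 (spin_rep (Cconj w) z))
  = spinor_add (spinor_scal (- snd v) (gamma1 z)) (spinor_scal (fst v) (gamma2 z)).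
Proof.
destruct z as [[p q] [r s]], w as [x y]; su2_unfold; split; pair_ring.
Qed.

Lemma base_spin_frame_above (p : V3) : unit_sphere p ->
  unit_sphere (spin_frame_above p) /\ base (spin_frame_above p) = p.
Proof.
destruct p as [[x y] z]; intros H; apply unit_V3 in H.
unfold dot in H; cbn [fst snd] in H.
assert (Hz : 0 <= (1 + z) / 2) by nra.
unfold spin_frame_above, coord; cbn [fst snd].
generalize (pow2_sqrt _ Hz); set (s := sqrt ((1 + z) / 2)); intros Hs.
destruct (Req_EM_T s 0) as [s0 | s0].
- assert (Ez : z = -1) by (rewrite s0 in Hs; lra).
  assert (Ex : x = 0) by (subst z; nra).
  assert (Ey : y = 0) by (subst z; nra).
  split; [apply unit_V4; simpl; ring|].
  subst x y z; su2_unfold; pair_ring.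
- assert (Ez : z = 2 * s ^ 2 - 1) by lra.
  assert (Exy : x * x + y * y = 4 * s ^ 2 * (1 - s ^ 2)) by (rewrite Ez in H; nra).
  assert (E : (x / (2 * s)) ^ 2 + (y / (2 * s)) ^ 2 = 1 - s ^ 2).
  { replace (_ + _) with ((x * x + y * y) / (4 * s ^ 2)) by (field; auto).
    rewrite Exy; field; auto. }
  split.
  + apply unit_V4; cbn [fst snd RtoC]; rewrite E; simpl; ring.
  + su2_unfold; rewrite E, Ez; clearbody s;
    repeat apply injective_projections; cbn; field; auto.
Qed.

Lemma base_fiber (g g' : V4) : unit_sphere g -> unit_sphere g' ->
  base g = base g' -> exists w, Cmod w = 1 /\ g' = su2_mul g (spin2 w).
Proof.
destruct g as [[a1 a2] [b1 b2]], g' as [[c1 c2] [d1 d2]]; intros Hg Hg' E.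
apply unit_V4 in Hg, Hg'; su2_unfold; injection E; clear E; intros E3 E2 E1.
set (x := a1 * c1 + a2 * c2 + (b1 * d1 + b2 * d2)).
set (y := a1 * c2 - a2 * c1 + (b1 * d2 - b2 * d1)).
assert (Ea : a1 ^ 2 + a2 ^ 2 = c1 ^ 2 + c2 ^ 2) by lra.
assert (Eb : b1 ^ 2 + b2 ^ 2 = d1 ^ 2 + d2 ^ 2) by lra.
assert (Er : a1 * b1 + a2 * b2 = c1 * d1 + c2 * d2) by lra.
assert (Ei : a1 * b2 - a2 * b1 = c1 * d2 - c2 * d1) by lra.
assert (R1 : c1 = a1 * x - a2 * y).
{ transitivity ((a1 ^ 2 + a2 ^ 2) * c1 + ((a1 * b1 + a2 * b2) * d1 + (a1 * b2 - a2 * b1) * d2));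
    [rewrite Er, Ei, Ea | unfold x, y; ring].
  transitivity (c1 * (c1 ^ 2 + c2 ^ 2 + (d1 ^ 2 + d2 ^ 2))); [rewrite Hg'|]; ring. }
assert (R2 : c2 = a1 * y + a2 * x).
{ transitivity ((a1 ^ 2 + a2 ^ 2) * c2 + ((a1 * b1 + a2 * b2) * d2 - (a1 * b2 - a2 * b1) * d1));
    [rewrite Er, Ei, Ea | unfold x, y; ring].
  transitivity (c2 * (c1 ^ 2 + c2 ^ 2 + (d1 ^ 2 + d2 ^ 2))); [rewrite Hg'|]; ring. }
assert (R3 : d1 = b1 * x - b2 * y).
{ transitivity ((b1 ^ 2 + b2 ^ 2) * d1 + ((a1 * b1 + a2 * b2) * c1 - (a1 * b2 - a2 * b1) * c2));
    [rewrite Er, Ei, Eb | unfold x, y; ring].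
  transitivity (d1 * (c1 ^ 2 + c2 ^ 2 + (d1 ^ 2 + d2 ^ 2))); [rewrite Hg'|]; ring. }
assert (R4 : d2 = b1 * y + b2 * x).
{ transitivity ((b1 ^ 2 + b2 ^ 2) * d2 + ((a1 * b1 + a2 * b2) * c2 + (a1 * b2 - a2 * b1) * c1));
    [rewrite Er, Ei, Eb | unfold x, y; ring].
  transitivity (d2 * (c1 ^ 2 + c2 ^ 2 + (d1 ^ 2 + d2 ^ 2))); [rewrite Hg'|]; ring. }
exists (x, y); split.
- assert (Hn : x ^ 2 + y ^ 2 = 1).
  { transitivity ((x ^ 2 + y ^ 2) * (a1 ^ 2 + a2 ^ 2 + (b1 ^ 2 + b2 ^ 2)));
      [rewrite Hg; ring|].
    rewrite <- Hg'; rewrite R1, R2, R3, R4; ring. }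
  unfold Cmod; cbn [fst snd]; rewrite Hn; apply sqrt_1.
- clearbody x y; rewrite R1, R2, R3, R4; pair_ring.
Qed.

Lemma equivariant_norm2 (psi : V4 -> spinor_space) (g : V4) (w : C) :
  equivariant psi -> unit_sphere g -> Cmod w = 1 ->
  spinor_norm2 (psi (su2_mul g (spin2 w))) = spinor_norm2 (psi g).
Proof.
intros He Hg Hw; rewrite (He g w Hg Hw).
assert (Hxy : 1 = fst w ^ 2 + snd w ^ 2) by (rewrite <- Cmod_sqr, Hw; ring).
unfold spinor_norm2, spin_rep; cbn [fst snd].
rewrite !Cmod_mult, !Rpow_mult_distr, !Cmod_sqr.
destruct w as [x y]; cbn [fst snd Cconj] in *.
replace (x ^ 2 + (- y) ^ 2) with 1 by (rewrite Hxy; ring).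
replace (x ^ 2 + (- - y) ^ 2) with 1 by (rewrite Hxy; ring).
ring.
Qed.

(* Main.v *)
Require Import Defs.
From Stdlib Require Import Reals Lra Lia List.
From Coquelicot Require Import Coquelicot.
Open Scope R_scope.

(** Let X = grad x_i, so that nabla X = - x_i g_0. The symmetric tensor
    T = du (x) du - |du|^2 g_0 / 2 + (h_1 e^{2u} - 1) g_0 / 2 + T_psi, where
    T_psi(v, w) = <v . nabla_w psi, psi> is symmetric with trace f |psi|^2 and
    divergence |psi|^2 df when D psi = f psi, f = h_2 e^u, satisfies
      div (T(X) - x_i grad u) = <grad h_1, X> e^{2u} / 2 + <grad h_2, X> e^u |psi|^2.
    This is checked in spherical coordinates, with psi read in the spin frame
    that lifts (e_theta, e_phi), where the divergence of a field (V, W) is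
    (d_theta (sin theta V) + d_phi W) / sin theta: its integral vanishes because
    sin theta is 0 at the poles and W is periodic in phi. *)

(** * Calculus of functions of two real variables *)

(** By the scalar equation the trace (h_1 e^{2u} - 1) + f |psi|^2 of T is - Delta u. Since nabla X =
    - x_i g_0, the divergence of T(X) therefore contains x_i Delta u, which the correction - x_i
    grad u removes; its other contribution - du(X) removes the du(X) that the constant -1 leaves in
    Delta u du(X). The identity obtained is one half of the claim.

    The obstacle is the pair of poles, where the frame (e_theta, e_phi) degenerates. The chart and
    its lift to SU(2) are treated as smooth maps defined on the whole plane: components in the frame
    are then smooth also where sin theta = 0, every equation is kept multiplied by sin theta, and no
    limit at the poles is taken. The lift changes sign after one turn in phi, which is harmless
    because T_psi is quadratic in psi. As D psi = f psi expresses the phi-derivatives of psi by its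
    theta-derivatives, T_psi is written with theta-derivatives alone, its last entry coming from the
    trace. *)

Ltac split4 := refine (conj _ (conj _ (conj _ _))).

(** The partial derivatives are functions on the whole plane, with no domain, because the spherical
    chart is defined there, poles included. The order is tracked since each derivative costs one. *)
Fixpoint smooth2 (k : nat) (F : R -> R -> R) : Prop :=
  (forall x y, continuity_2d_pt F x y) /\
  match k with
  | O => True
  | S k => exists F1 F2 : R -> R -> R,
      (forall x y, is_derive (fun t => F t y) x (F1 x y)) /\
      (forall x y, is_derive (F x) y (F2 x y)) /\
      smooth2 k F1 /\ smooth2 k F2
  end.

Lemma smooth2_continuity k F x y : smooth2 k F -> continuity_2d_pt F x y.
Proof. destruct k; intros [H _]; apply H. Qed.

Lemma smooth2_pred k F : smooth2 (S k) F -> smooth2 k F.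
Proof.
revert F; induction k as [|k IH]; intros F [Hc (F1 & F2 & H1 & H2 & S1 & S2)].
- split; auto.
- split; auto; exists F1, F2; auto.
Qed.

Lemma smooth2_ext k F G :
  (forall x y, F x y = G x y) -> smooth2 k F -> smooth2 k G.
Proof.
intros E H.
assert (C : forall x y, continuity_2d_pt G x y).
{ intros x y; apply (continuity_2d_pt_ext F); auto; eapply smooth2_continuity; eauto. }
destruct k; [split; auto|].
destruct H as [_ (F1 & F2 & H1 & H2 & S1 & S2)].
split; auto; exists F1, F2; split4; auto; intros x y.
- apply (is_derive_ext (fun t => F t y)); auto.
- apply (is_derive_ext (F x)); auto.
Qed.

Lemma smooth2_Derive_l k F : smooth2 (S k) F ->
  (forall x y, is_derive (fun t => F t y) x (Derive (fun t => F t y) x)) /\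
  smooth2 k (fun x y => Derive (fun t => F t y) x).
Proof.
intros [_ (F1 & F2 & H1 & _ & S1 & _)]; split.
- intros x y; apply Derive_correct; eexists; apply H1.
- revert S1; apply smooth2_ext; intros x y; symmetry; apply is_derive_unique, H1.
Qed.

Lemma smooth2_Derive_r k F : smooth2 (S k) F ->
  (forall x y, is_derive (F x) y (Derive (F x) y)) /\
  smooth2 k (fun x y => Derive (F x) y).
Proof.
intros [_ (F1 & F2 & _ & H2 & _ & S2)]; split.
- intros x y; apply Derive_correct; eexists; apply H2.
- revert S2; apply smooth2_ext; intros x y; symmetry; apply is_derive_unique, H2.
Qed.

Lemma smooth2_const k a : smooth2 k (fun _ _ => a).
Proof.
revert a; induction k as [|k IH]; intros a; (split; [intros; apply continuity_2d_pt_const|]); auto.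
exists (fun _ _ => 0), (fun _ _ => 0); split4; auto; intros;
  exact (is_derive_const a _).
Qed.

Lemma smooth2_plus k F G :
  smooth2 k F -> smooth2 k G -> smooth2 k (fun x y => F x y + G x y).
Proof.
revert F G; induction k as [|k IH]; intros F G HF HG;
  (split; [intros; apply continuity_2d_pt_plus; eapply smooth2_continuity; eauto|]); auto.
destruct HF as [_ (F1 & F2 & ? & ? & ? & ?)], HG as [_ (G1 & G2 & ? & ? & ? & ?)].
exists (fun x y => F1 x y + G1 x y), (fun x y => F2 x y + G2 x y).
split4; auto; intros x y.
- apply (is_derive_plus (fun t => F t y) (fun t => G t y)); auto.
- apply (is_derive_plus (F x) (G x)); auto.
Qed.

Lemma smooth2_mult k F G :
  smooth2 k F -> smooth2 k G -> smooth2 k (fun x y => F x y * G x y).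
Proof.
revert F G; induction k as [|k IH]; intros F G HF HG;
  (split; [intros; apply continuity_2d_pt_mult; eapply smooth2_continuity; eauto|]); auto.
assert (HF' := smooth2_pred _ _ HF); assert (HG' := smooth2_pred _ _ HG).
destruct HF as [_ (F1 & F2 & ? & ? & ? & ?)], HG as [_ (G1 & G2 & ? & ? & ? & ?)].
exists (fun x y => F1 x y * G x y + F x y * G1 x y),
  (fun x y => F2 x y * G x y + F x y * G2 x y).
split4; try (apply smooth2_plus; apply IH; auto); intros x y.
- apply (is_derive_mult (fun t => F t y) (fun t => G t y)); auto; apply Rmult_comm.
- apply (is_derive_mult (F x) (G x)); auto; apply Rmult_comm.
Qed.

Lemma smooth2_opp k F : smooth2 k F -> smooth2 k (fun x y => - F x y).
Proof.
intros H; apply (smooth2_ext k (fun x y => -1 * F x y)); [intros; ring|].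
apply smooth2_mult; auto using smooth2_const.
Qed.

Lemma smooth2_minus k F G :
  smooth2 k F -> smooth2 k G -> smooth2 k (fun x y => F x y - G x y).
Proof. intros; apply smooth2_plus; auto using smooth2_opp. Qed.

Lemma smooth2_pow k F n : smooth2 k F -> smooth2 k (fun x y => F x y ^ n).
Proof.
intros H; induction n as [|n IH]; [exact (smooth2_const k 1)|].
exact (smooth2_mult k F _ H IH).
Qed.

Lemma smooth2_div k F a : smooth2 k F -> smooth2 k (fun x y => F x y / a).
Proof. intros; apply smooth2_mult; auto using smooth2_const. Qed.

Lemma smooth2_fst k : smooth2 k (fun x _ => x).
Proof.
assert (C : forall x y, continuity_2d_pt (fun x _ : R => x) x y)
  by (intros; apply continuity_2d_pt_id1).
destruct k; split; auto.
exists (fun _ _ => 1), (fun _ _ => 0); split4; try apply smooth2_const; intros x y.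
- exact (is_derive_id x).
- exact (is_derive_const x y).
Qed.

Lemma smooth2_snd k : smooth2 k (fun _ y => y).
Proof.
assert (C : forall x y, continuity_2d_pt (fun _ y : R => y) x y)
  by (intros; apply continuity_2d_pt_id2).
destruct k; split; auto.
exists (fun _ _ => 0), (fun _ _ => 1); split4; try apply smooth2_const; intros x y.
- exact (is_derive_const y x).
- exact (is_derive_id y).
Qed.

Lemma continuity_2d_comp (h : R -> R) F x y : (forall t, continuous h t) ->
  continuity_2d_pt F x y -> continuity_2d_pt (fun x y => h (F x y)) x y.
Proof.
intros Hh HF; apply continuity_2d_pt_filterlim; apply continuity_2d_pt_filterlim in HF.
eapply filterlim_comp; [exact HF|apply Hh].
Qed.

(** No class C^k in one variable is introduced: what is asked of [h] is that [dh] composed with [F]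
    be smooth to one order less, which an induction on the order supplies for [exp], and for [sin]
    and [cos] jointly. *)
Lemma smooth2_comp_family k (h dh : R -> R) F :
  (forall t, is_derive h t (dh t)) ->
  smooth2 (S k) F -> smooth2 k (fun x y => dh (F x y)) ->
  smooth2 (S k) (fun x y => h (F x y)).
Proof.
intros Hh HF Hd; split.
- intros x y; apply continuity_2d_comp; [|eapply smooth2_continuity; eauto].
  intros t; apply (ex_derive_continuous h); eexists; apply Hh.
- destruct HF as [_ (F1 & F2 & ? & ? & ? & ?)].
  exists (fun x y => F1 x y * dh (F x y)), (fun x y => F2 x y * dh (F x y)).
  split4; try (apply smooth2_mult; auto); intros x y.
  + apply (is_derive_comp h (fun t => F t y)); auto.
  + apply (is_derive_comp h (F x)); auto.
Qed.

Lemma smooth2_exp k F : smooth2 k F -> smooth2 k (fun x y => exp (F x y)).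
Proof.
revert F; induction k as [|k IH]; intros F HF.
- split; auto; intros x y; apply continuity_2d_comp; [|eapply smooth2_continuity; eauto].
  intros t; apply (ex_derive_continuous exp); eexists; apply is_derive_exp.
- apply (smooth2_comp_family k exp exp); auto using smooth2_pred.
  apply is_derive_exp.
Qed.

Lemma smooth2_sin_cos k F : smooth2 k F ->
  smooth2 k (fun x y => sin (F x y)) /\ smooth2 k (fun x y => cos (F x y)).
Proof.
revert F; induction k as [|k IH]; intros F HF.
- split; (split; auto; intros x y; apply continuity_2d_comp;
    [|eapply smooth2_continuity; eauto]); intros t.
  + apply (ex_derive_continuous sin); eexists; apply is_derive_sin.
  + apply (ex_derive_continuous cos); eexists; apply is_derive_cos.
- destruct (IH F) as [Hs Hc]; [auto using smooth2_pred|]; split.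
  + apply (smooth2_comp_family k sin cos); auto; apply is_derive_sin.
  + apply (smooth2_comp_family k cos (fun t => - sin t)); auto using smooth2_opp.
    apply is_derive_cos.
Qed.

Lemma smooth2_sin k F : smooth2 k F -> smooth2 k (fun x y => sin (F x y)).
Proof. apply smooth2_sin_cos. Qed.

Lemma smooth2_cos k F : smooth2 k F -> smooth2 k (fun x y => cos (F x y)).
Proof. apply smooth2_sin_cos. Qed.

Ltac smooth2_auto :=
  repeat first
    [ assumption | apply smooth2_plus | apply smooth2_minus | apply smooth2_mult
    | apply smooth2_div | apply smooth2_pow | apply smooth2_opp
    | apply smooth2_exp | apply smooth2_sin | apply smooth2_cos
    | apply smooth2_fst | apply smooth2_snd | apply smooth2_const ].

Lemma mixed_partials (F F1 F2 F12 F21 : R -> R -> R) :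
  (forall x y, is_derive (fun t => F t y) x (F1 x y)) ->
  (forall x y, is_derive (F x) y (F2 x y)) ->
  (forall x y, is_derive (F1 x) y (F12 x y)) ->
  (forall x y, is_derive (fun t => F2 t y) x (F21 x y)) ->
  (forall x y, continuity_2d_pt F12 x y) ->
  (forall x y, continuity_2d_pt F21 x y) ->
  forall x y, F12 x y = F21 x y.
Proof.
intros H1 H2 H12 H21 C12 C21 x y.
assert (E1 : forall u v, is_derive (fun z => Derive (fun t => F t z) u) v (F12 u v)).
{ intros u v; apply (is_derive_ext (F1 u)); auto.
  intros t; symmetry; apply is_derive_unique, H1. }
assert (E2 : forall u v, is_derive (fun z => Derive (fun t => F z t) v) u (F21 u v)).
{ intros u v; apply (is_derive_ext (fun z => F2 z v)); auto.
  intros t; symmetry; apply is_derive_unique, H2. }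
rewrite <- (is_derive_unique _ _ _ (E1 x y)), <- (is_derive_unique _ _ _ (E2 x y)).
symmetry; apply Schwarz.
- exists (mkposreal 1 Rlt_0_1); intros u v _ _; split4; eexists; eauto.
- apply (continuity_2d_pt_ext F21); auto; intros; symmetry; apply is_derive_unique, E2.
- apply (continuity_2d_pt_ext F12); auto; intros; symmetry; apply is_derive_unique, E1.
Qed.

(** * Iterated integrals over a rectangle *)

Lemma continuity_2d_pt_l F x y :
  continuity_2d_pt F x y -> continuous (fun t => F t y) x.
Proof.
intros H; apply continuity_2d_pt_filterlim in H.
apply (continuous_comp_2 (fun t => t) (fun _ => y) F).
- apply continuous_id.
- apply continuous_const.
- exact H.
Qed.

Lemma ex_RInt_inner k F a b y : smooth2 k F -> ex_RInt (fun x => F x y) a b.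
Proof.
intros H; apply (@ex_RInt_continuous R_CompleteNormedModule); intros x _.
apply continuity_2d_pt_l; eapply smooth2_continuity; eauto.
Qed.

Lemma is_derive_RInt_inner (F F2 : R -> R -> R) a b y :
  (forall x y, is_derive (F x) y (F2 x y)) ->
  (forall x y, continuity_2d_pt F x y) -> (forall x y, continuity_2d_pt F2 x y) ->
  is_derive (fun y => RInt (fun x => F x y) a b) y (RInt (fun x => F2 x y) a b).
Proof.
intros HF C C2.
rewrite (RInt_ext _ (fun x => Derive (fun u => F x u) y))
  by (intros; symmetry; apply is_derive_unique, HF).
apply (is_derive_RInt_param (fun y x => F x y)).
- exists (mkposreal 1 Rlt_0_1); intros z _ t _; eexists; apply HF.
- intros t _; specialize (C2 t y).
  apply continuity_2d_pt_filterlim; apply continuity_2d_pt_filterlim in C2.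
  replace (Derive (fun z => F t z) y) with (F2 t y) by (symmetry; apply is_derive_unique, HF).
  (* The parameter is the first variable in [is_derive_RInt_param], so the continuity of [F2] is
     carried through the exchange of variables. *)
  apply (filterlim_ext (fun z : R * R => F2 (snd z) (fst z))).
  { intros z; symmetry; apply is_derive_unique, HF. }
  apply (continuous_comp_2 (fun z : R * R => snd z) (fun z : R * R => fst z) F2 (y, t)).
  + apply continuous_snd.
  + apply continuous_fst.
  + exact C2.
- exists (mkposreal 1 Rlt_0_1); intros z _.
  apply (@ex_RInt_continuous R_CompleteNormedModule); intros x _.
  apply continuity_2d_pt_l; auto.
Qed.

(** Continuity is deduced from differentiability under the integral sign; hence order 1 here, and
    order 2 for the fields of the divergence theorem. *)
Lemma continuous_RInt_inner F a b y : smooth2 1 F ->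
  continuous (fun y => RInt (fun x => F x y) a b) y.
Proof.
intros [C (F1 & F2 & H1 & H2 & S1 & S2)].
apply (ex_derive_continuous (fun y => RInt (fun x => F x y) a b)).
eexists; apply (is_derive_RInt_inner F F2); auto.
intros; eapply smooth2_continuity; eauto.
Qed.

Lemma ex_RInt_outer F a b c d : smooth2 1 F ->
  ex_RInt (fun y => RInt (fun x => F x y) a b) c d.
Proof.
intros H; apply (@ex_RInt_continuous R_CompleteNormedModule); intros y _.
now apply continuous_RInt_inner.
Qed.

Lemma RInt2_plus F G a b c d : smooth2 1 F -> smooth2 1 G ->
  RInt (fun y => RInt (fun x => F x y + G x y) a b) c d
  = RInt (fun y => RInt (fun x => F x y) a b) c d
    + RInt (fun y => RInt (fun x => G x y) a b) c d.
Proof.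
intros HF HG; rewrite <- (RInt_plus (V := R_CompleteNormedModule));
  try now apply ex_RInt_outer.
apply RInt_ext; intros y _.
apply (RInt_plus (V := R_CompleteNormedModule)); eapply ex_RInt_inner; eauto.
Qed.

(** The order of integration is never exchanged: the inner integral of [P1] is zero for each [y],
    while that of [Q2] is the [y]-derivative of the inner integral of [Q], which takes equal values
    at [c] and [d]. *)
Lemma divergence_theorem (P P1 Q Q2 : R -> R -> R) a b c d :
  smooth2 2 P -> smooth2 2 Q ->
  (forall x y, is_derive (fun t => P t y) x (P1 x y)) ->
  (forall x y, is_derive (Q x) y (Q2 x y)) ->
  (forall y, P a y = P b y) -> (forall x, Q x c = Q x d) ->
  RInt (fun y => RInt (fun x => P1 x y + Q2 x y) a b) c d = 0.
Proof.
intros SP SQ HP HQ EP EQ.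
assert (SP1 : smooth2 1 P1).
{ apply smooth2_Derive_l in SP; destruct SP as [_ SP]; revert SP.
  apply smooth2_ext; intros; apply is_derive_unique, HP. }
assert (SQ2 : smooth2 1 Q2).
{ apply smooth2_Derive_r in SQ; destruct SQ as [_ SQ]; revert SQ.
  apply smooth2_ext; intros; apply is_derive_unique, HQ. }
rewrite (RInt2_plus P1 Q2) by assumption.
replace (RInt (fun y => RInt (fun x => P1 x y) a b) c d) with 0.
2:{ rewrite (RInt_ext _ (fun _ => 0)).
  { rewrite RInt_const; symmetry; apply Rmult_0_r. }
  intros y _; apply is_RInt_unique.
  replace 0 with (minus (P b y) (P a y)) by (rewrite EP; apply (minus_eq_zero (G := R_AbelianGroup))).
  apply (is_RInt_derive (V := R_CompleteNormedModule) (fun x => P x y) (fun x => P1 x y)); intros x _; auto.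
  apply continuity_2d_pt_l; eapply smooth2_continuity; eauto. }
rewrite Rplus_0_l; apply is_RInt_unique.
assert (E0 : 0 = minus (RInt (fun x => Q x d) a b) (RInt (fun x => Q x c) a b)).
{ rewrite (RInt_ext (fun x => Q x d) (fun x => Q x c)) by (intros; symmetry; apply EQ).
  symmetry; apply (minus_eq_zero (G := R_AbelianGroup)). }
rewrite E0.
apply (is_RInt_derive (V := R_CompleteNormedModule) (fun y => RInt (fun x => Q x y) a b)); intros y _.
- apply is_derive_RInt_inner; auto; intros; eapply smooth2_continuity; eauto.
- now apply continuous_RInt_inner.
Qed.

(** * Differentiation along curves in a normed space *)

Lemma is_derive_comp_curve {V : NormedModule R_AbsRing} (F : V -> R) (l : V -> R)
    (c : R -> V) (t : R) (v : V) :
  filterdiff F (locally (c t)) l -> is_derive c t v ->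
  is_derive (fun s => F (c s)) t (l v).
Proof.
intros HF Hc.
apply (filterdiff_ext_lin _ (fun y : R => l (scal y v))).
- apply (filterdiff_comp' c F t (fun y => scal y v) l); auto.
- intros y; apply (linear_scal l); apply HF.
Qed.

Lemma is_derive_line {V : NormedModule R_AbsRing} (x v : V) (t : R) :
  is_derive (fun s : R => plus x (scal s v)) t v.
Proof.
assert (H : is_derive (fun s : R => plus x (scal s v)) t (plus zero (scal (one : R_AbsRing) v))).
{ apply (is_derive_plus (fun _ => x) (fun s : R => scal s v)).
  - apply is_derive_const.
  - apply (is_derive_scal_l (fun s : R => s)), (is_derive_id (K := R_AbsRing)). }
now rewrite plus_zero_l, (@scal_one R_AbsRing) in H.
Qed.

Lemma line_at_0 {V : NormedModule R_AbsRing} (x v : V) : plus x (scal (0 : R) v) = x.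
Proof.
rewrite <- (plus_zero_r x) at 2; f_equal; apply (@scal_zero_l R_AbsRing).
Qed.

(** Whatever differential [ex_filterdiff] provides, its values are the directional derivatives; this
    makes [dirderiv] linear in the direction, hence computable on a basis. *)
Lemma filterdiff_dirderiv {V : NormedModule R_AbsRing} (F : V -> R) (x : V) :
  ex_filterdiff F (locally x) -> filterdiff F (locally x) (fun v => dirderiv v F x).
Proof.
intros [l Hl]; apply (filterdiff_ext_lin _ l); auto.
intros v; symmetry; apply is_derive_unique.
apply (is_derive_comp_curve F l (fun t => plus x (scal t v))).
- now rewrite line_at_0.
- apply is_derive_line.
Qed.

Lemma is_derive_dirderiv {V : NormedModule R_AbsRing} (F : V -> R)
    (c : R -> V) (t : R) (v : V) :
  ex_filterdiff F (locally (c t)) -> is_derive c t v ->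
  is_derive (fun s => F (c s)) t (dirderiv v F (c t)).
Proof.
intros HF; apply (is_derive_comp_curve F (fun v => dirderiv v F (c t))).
now apply filterdiff_dirderiv.
Qed.

(** Maps into [V] are handled through coordinate functions in a finite family, so that R^3 and C^2
    share one chain rule. [sum_n] includes its last index: the family has [n] + 1 members. *)
Definition lin_comb {V : NormedModule R_AbsRing} (b : nat -> V) (n : nat) (a : nat -> R) : V :=
  sum_n (fun j => scal (a j) (b j)) n.

Lemma linear_lin_comb {V : NormedModule R_AbsRing} (l : V -> R) b n a :
  is_linear l -> l (lin_comb b n a) = sum_n (fun j => a j * l (b j)) n.
Proof.
intros Hl; unfold lin_comb; induction n as [|n IH].
- rewrite !sum_O; apply (linear_scal l Hl).
- rewrite !sum_Sn, (linear_plus l Hl), IH; f_equal; apply (linear_scal l Hl).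
Qed.

Lemma dirderiv_lin_comb {V : NormedModule R_AbsRing} (F : V -> R) x b n a :
  ex_filterdiff F (locally x) ->
  dirderiv (lin_comb b n a) F x = sum_n (fun j => a j * dirderiv (b j) F x) n.
Proof.
intros HF; apply (linear_lin_comb (fun v => dirderiv v F x)).
now apply filterdiff_dirderiv.
Qed.

Lemma is_derive_lin_comb {V : NormedModule R_AbsRing} (b : nat -> V) n
    (c : nat -> R -> R) (d : nat -> R) t :
  (forall j, is_derive (c j) t (d j)) ->
  is_derive (fun s => lin_comb b n (fun j => c j s)) t (lin_comb b n d).
Proof.
intros H; unfold lin_comb; induction n as [|n IH].
- rewrite sum_O; apply (is_derive_ext (fun s => scal (c O s) (b O))).
  { intros; now rewrite sum_O. }
  apply (is_derive_scal_l (c O)), H.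
- rewrite sum_Sn.
  apply (is_derive_ext (fun s => plus (sum_n (fun j => scal (c j s) (b j)) n)
    (scal (c (S n) s) (b (S n))))).
  { intros; now rewrite sum_Sn. }
  apply (is_derive_plus (fun s => sum_n (fun j => scal (c j s) (b j)) n)
    (fun s => scal (c (S n) s) (b (S n)))); auto.
  apply (is_derive_scal_l (c (S n))), H.
Qed.

Lemma smooth2_sum_n k (G : nat -> R -> R -> R) n :
  (forall j, smooth2 k (G j)) -> smooth2 k (fun x y => sum_n (fun j => G j x y) n).
Proof.
intros H; induction n as [|n IH].
- apply (smooth2_ext k (G O)); auto; intros; now rewrite sum_O.
- apply (smooth2_ext k (fun x y => sum_n (fun j => G j x y) n + G (S n) x y)).
  + intros; now rewrite sum_Sn.
  + now apply smooth2_plus.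
Qed.

Lemma continuous_lin_comb {V : NormedModule R_AbsRing} (b : nat -> V) n
    (c : nat -> R -> R -> R) x y :
  (forall j, continuity_2d_pt (c j) x y) ->
  continuous (fun z : R * R => lin_comb b n (fun j => c j (fst z) (snd z))) (x, y).
Proof.
intros H; unfold lin_comb; induction n as [|n IH].
- apply (continuous_ext (fun z : R * R => scal (c O (fst z) (snd z)) (b O))).
  { intros; now rewrite sum_O. }
  apply (continuous_scal_l (fun z : R * R => c O (fst z) (snd z))).
  now apply continuity_2d_pt_filterlim.
- apply (continuous_ext (fun z : R * R => plus
    (sum_n (fun j => scal (c j (fst z) (snd z)) (b j)) n)
    (scal (c (S n) (fst z) (snd z)) (b (S n))))).
  { intros; now rewrite sum_Sn. }
  apply (continuous_plus (V := V)); auto.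
  apply (continuous_scal_l (fun z : R * R => c (S n) (fst z) (snd z))).
  now apply continuity_2d_pt_filterlim.
Qed.

Lemma of_class_C_continuous {V : NormedModule R_AbsRing} k (U : V -> Prop) (F : V -> R) x :
  of_class_C k U F -> U x -> continuous F x.
Proof.
destruct k; intros H Hx; [now apply H|].
apply (filterdiff_continuous F), H, Hx.
Qed.

(** By the chain rule a partial derivative of the composite is a sum of products of a derivative of
    [c j] with the composite of [dirderiv (b j) F]. The latter has the same shape, one class lower,
    hence the induction on [k] for all [F]. *)
Lemma smooth2_comp {V : NormedModule R_AbsRing} (U : V -> Prop) (b : nat -> V) n
    (c : nat -> R -> R -> R) k F :
  of_class_C k U F -> (forall j, smooth2 k (c j)) ->
  (forall x y, U (lin_comb b n (fun j => c j x y))) ->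
  smooth2 k (fun x y => F (lin_comb b n (fun j => c j x y))).
Proof.
intros HF Hc HU; revert F HF Hc; induction k as [|k IH]; intros F HF Hc.
all: assert (C : forall x y,
  continuity_2d_pt (fun x y => F (lin_comb b n (fun j => c j x y))) x y)
  by (intros x y; apply continuity_2d_pt_filterlim;
      apply (continuous_comp (fun z : R * R => lin_comb b n (fun j => c j (fst z) (snd z))) F (x, y));
      [ apply continuous_lin_comb; intros; eapply smooth2_continuity; eauto
      | eapply of_class_C_continuous; eauto; apply HU ]).
- split; auto.
- destruct HF as [HD HF]; split; auto.
  exists (fun x y => sum_n (fun j => Derive (fun t => c j t y) x *
     dirderiv (b j) F (lin_comb b n (fun j => c j x y))) n),
   (fun x y => sum_n (fun j => Derive (c j x) y *
     dirderiv (b j) F (lin_comb b n (fun j => c j x y))) n).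
  split4.
  + intros x y; rewrite <- dirderiv_lin_comb by apply HD, HU.
    apply (is_derive_dirderiv F (fun t => lin_comb b n (fun j => c j t y))); [apply HD, HU|].
    apply (is_derive_lin_comb b n (fun j t => c j t y)); intros j; now apply (smooth2_Derive_l k).
  + intros x y; rewrite <- dirderiv_lin_comb by apply HD, HU.
    apply (is_derive_dirderiv F (fun t => lin_comb b n (fun j => c j x t))); [apply HD, HU|].
    apply (is_derive_lin_comb b n (fun j t => c j x t)); intros j; now apply (smooth2_Derive_r k).
  + apply smooth2_sum_n; intros j; apply smooth2_mult; [now apply smooth2_Derive_l|].
    apply IH; auto using smooth2_pred.
  + apply smooth2_sum_n; intros j; apply smooth2_mult; [now apply smooth2_Derive_r|].
    apply IH; auto using smooth2_pred.
Qed.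

(** * The round sphere in spherical coordinates *)

Lemma unit_sphere_neq_zero {V : NormedModule R_AbsRing} (x : V) : unit_sphere x -> x <> zero.
Proof. intros H ->; unfold unit_sphere in H; rewrite norm_zero in H; lra. Qed.

Lemma ext_unit_sphere {V : NormedModule R_AbsRing} {T : Type} (f : V -> T) x :
  unit_sphere x -> ext f x = f x.
Proof.
intros H; unfold ext; rewrite H, Rinv_1; f_equal; apply (@scal_one R_AbsRing).
Qed.

Lemma smooth_on_sphere_ex_filterdiff {V : NormedModule R_AbsRing} (f : V -> R) x :
  smooth_on_sphere f -> unit_sphere x -> ex_filterdiff (ext f) (locally x).
Proof. intros Hf Hx; apply (Hf 1%nat); now apply unit_sphere_neq_zero. Qed.

Lemma is_derive_on_sphere {V : NormedModule R_AbsRing} (f : V -> R) (c : R -> V) t v x :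
  smooth_on_sphere f -> (forall s, unit_sphere (c s)) -> c t = x -> is_derive c t v ->
  is_derive (fun s => f (c s)) t (dirderiv v (ext f) x).
Proof.
intros Hf Hc <- Hd; apply (is_derive_ext (fun s => ext f (c s))).
- intros s; now apply ext_unit_sphere.
- apply is_derive_dirderiv; auto; now apply smooth_on_sphere_ex_filterdiff.
Qed.

Lemma smooth2_on_sphere {V : NormedModule R_AbsRing} (b : nat -> V) n
    (c : nat -> R -> R -> R) (s : R -> R -> V) k f :
  smooth_on_sphere f -> (forall j, smooth2 k (c j)) ->
  (forall x y, s x y = lin_comb b n (fun j => c j x y)) ->
  (forall x y, unit_sphere (s x y)) ->
  smooth2 k (fun x y => f (s x y)).
Proof.
intros Hf Hc Hs Hu; apply (smooth2_ext k (fun x y => ext f (lin_comb b n (fun j => c j x y)))).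
- intros x y; rewrite <- Hs; now apply ext_unit_sphere.
- apply (smooth2_comp (fun x => x <> zero)); auto.
  intros x y; rewrite <- Hs; now apply unit_sphere_neq_zero.
Qed.

Ltac to_R :=
  repeat match goal with
  | x : NormedModule.sort R_AbsRing R_NormedModule |- _ => change R in x
  end.

Ltac R_eq := match goal with |- @eq _ ?a ?b => change (@eq R a b) end.

Ltac coord_ring :=
  to_R;
  repeat apply injective_projections; cbn; unfold plus, scal; cbn; unfold mult; cbn;
  R_eq; ring.

Lemma V3_lin_comb (v : V3) :
  v = lin_comb (fun j => basis (S j)) 2 (fun j => coord (S j) v).
Proof.
unfold lin_comb; rewrite !sum_Sn, sum_O; destruct v as [[x y] z]; coord_ring.
Qed.

Lemma is_derive_V3 (c1 c2 c3 : R -> R) t d1 d2 d3 :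
  is_derive c1 t d1 -> is_derive c2 t d2 -> is_derive c3 t d3 ->
  is_derive (fun s => ((c1 s, c2 s), c3 s) : V3) t ((d1, d2), d3).
Proof.
intros H1 H2 H3.
rewrite (V3_lin_comb ((d1, d2), d3)).
apply (is_derive_ext (fun s => lin_comb (fun j => basis (S j)) 2
  (fun j => coord (S j) ((c1 s, c2 s), c3 s)))).
- intros; symmetry; apply V3_lin_comb.
- apply (is_derive_lin_comb _ _ (fun j s => coord (S j) ((c1 s, c2 s), c3 s))).
  intros [|[|[|j]]]; auto; apply (is_derive_const 0).
Qed.

Lemma dirderiv_V3 (F : V3 -> R) x (v : V3) : ex_filterdiff F (locally x) ->
  dirderiv v F x = dot ((dirderiv (basis 1) F x, dirderiv (basis 2) F x),
                        dirderiv (basis 3) F x) v.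
Proof.
intros HF; rewrite (V3_lin_comb v) at 1; rewrite dirderiv_lin_comb by auto.
rewrite !sum_Sn, sum_O; unfold dot, plus; simpl; ring.
Qed.

Lemma norm_V3 (v : V3) : norm v = sqrt (dot v v).
Proof.
destruct v as [[x y] z].
change (norm _) with (sqrt (sqrt (Rabs x ^ 2 + Rabs y ^ 2) ^ 2 + Rabs z ^ 2)).
rewrite pow2_sqrt, !pow2_abs by (apply Rplus_le_le_0_compat; apply pow2_ge_0).
f_equal; unfold dot; cbn [fst snd]; to_R; ring.
Qed.

(** [ext] composes with the radial retraction, whose differential at a unit vector [n] is the
    projection v - <n, v> n. The main use is for [partial i f], which is homogeneous of degree -1
    and so need not agree with its own [ext] off the sphere. *)
Lemma dirderiv_ext_tangential (F : V3 -> R) (n v : V3) :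
  unit_sphere n -> ex_filterdiff F (locally n) ->
  dirderiv v (ext F) n = dirderiv (plus v (scal (- dot n v) n)) F n.
Proof.
intros Hn HF; apply is_derive_unique; unfold ext.
set (r := fun t : R => / norm (plus n (scal t v))).
assert (Hr0 : r 0 = 1) by (unfold r; rewrite line_at_0, Hn; apply Rinv_1).
assert (E : scal (r 0) (plus n (scal (0 : R) v)) = n)
  by (rewrite line_at_0, Hr0; apply (@scal_one R_AbsRing V3)).
pose proof Hn as Hn'; apply unit_V3 in Hn'.
assert (Hr : is_derive r 0 (- dot n v)).
{ apply (is_derive_ext (fun t => / sqrt (1 + 2 * t * dot n v + t ^ 2 * dot v v))).
  { intros t; unfold r; rewrite norm_V3, <- Hn'; do 2 f_equal.
    unfold dot; cbn; unfold mult; cbn; to_R; ring. }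
  auto_derive; replace (1 + 2 * 0 * dot n v + 0 * (0 * 1) * dot v v) with 1 by ring;
    rewrite ?sqrt_1; [split; [lra|split; auto; lra]|field]. }
replace (plus v (scal (- dot n v) n)) with
  (plus (scal (- dot n v) n) (scal (1 : R) v) : V3).
2:{ rewrite plus_comm; f_equal; apply (@scal_one R_AbsRing V3). }
rewrite <- E at 3.
apply (is_derive_dirderiv F (fun t => scal (r t) (plus n (scal t v)))).
{ now rewrite E. }
apply (is_derive_ext (fun t => plus (scal (r t) n) (scal (r t * t) v))).
{ intros t; rewrite (scal_distr_l (V := V3) (r t)); f_equal; symmetry.
  apply (scal_assoc (V := V3) (r t)). }
apply (is_derive_plus (fun t => scal (r t) n) (fun t => scal (r t * t) v)).
- now apply (is_derive_scal_l r).
- apply (is_derive_scal_l (fun t => r t * t)).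
  replace 1 with (- dot n v * 0 + r 0 * 1) by (rewrite Hr0; ring).
  apply (is_derive_mult r (fun t => t)); auto; [apply (is_derive_id (K := R_AbsRing))|].
  apply Rmult_comm.
Qed.

Lemma line_radial {V : NormedModule R_AbsRing} (x : V) (t : R) :
  plus x (scal t x) = scal (1 + t) x.
Proof.
rewrite (scal_distr_r (1 : R) t); f_equal; symmetry; apply (@scal_one R_AbsRing).
Qed.

Lemma grad_radial (f : V3 -> R) n : smooth_on_sphere f -> unit_sphere n ->
  dot (grad f n) n = 0.
Proof.
intros Hf Hn.
transitivity (dirderiv n (ext f) n).
{ symmetry; apply dirderiv_V3; now apply smooth_on_sphere_ex_filterdiff. }
apply is_derive_unique.
(* Normalizing (1 + t) n returns [n] only while 1 + t > 0, hence a local argument. *)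
apply (is_derive_ext_loc (fun _ => f n)); [|apply (is_derive_const (f n))].
exists (mkposreal 1 Rlt_0_1); intros t Ht.
assert (H1 : 0 < 1 + t).
{ change (Rabs (t - 0) < 1) in Ht; apply Rabs_def2 in Ht; lra. }
unfold ext; f_equal.
assert (En : norm (scal (1 + t) n) = 1 + t).
{ rewrite norm_V3; replace (dot _ _) with ((1 + t) ^ 2 * dot n n)
    by (unfold dot; cbn; unfold mult; cbn; ring).
  rewrite (proj1 (unit_V3 n) Hn), Rmult_1_r; apply sqrt_pow2; lra. }
rewrite (line_radial (V := V3)), En, (scal_assoc (V := V3)).
change (mult (/ (1 + t)) (1 + t)) with (/ (1 + t) * (1 + t)).
rewrite Rinv_l by lra.
symmetry; apply (@scal_one R_AbsRing V3).
Qed.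

(** * The spherical chart and its orthonormal frame *)

Definition sph (x y : R) : V3 := ((sin x * cos y, sin x * sin y), cos x).
Definition e_theta (x y : R) : V3 := ((cos x * cos y, cos x * sin y), - sin x).
(** The velocity of the chart in [y] is [sin x] times this vector, which keeps length 1 on the lines
    over the poles; components along it are thus smooth on the whole plane. *)
Definition e_phi (x y : R) : V3 := ((- sin y, cos y), 0).

Lemma sin_sqr x : sin x ^ 2 = 1 - cos x ^ 2.
Proof. generalize (sin2_cos2 x); unfold Rsqr; nra. Qed.

Ltac trig_ring x y := ring [(sin_sqr x) (sin_sqr y)].

Lemma unit_sph x y : unit_sphere (sph x y).
Proof. apply unit_V3; unfold dot, sph; cbn [fst snd]; trig_ring x y. Qed.

Lemma is_derive_sph_l x y : is_derive (fun t => sph t y) x (e_theta x y).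
Proof. apply is_derive_V3; auto_derive; auto; ring. Qed.

Lemma is_derive_sph_r x y : is_derive (sph x) y (scal (sin x) (e_phi x y)).
Proof.
apply (is_derive_V3 (fun y => sin x * cos y) (fun y => sin x * sin y) (fun _ => cos x));
  auto_derive; auto; cbn; unfold mult; cbn; ring.
Qed.

Lemma dot_scal_r (r : R) v w : dot v (scal r w) = r * dot v w.
Proof. unfold dot; cbn; unfold mult; cbn; ring. Qed.

Lemma is_derive_sphere (f : V3 -> R) (c : R -> V3) t v :
  smooth_on_sphere f -> (forall s, unit_sphere (c s)) -> is_derive c t v ->
  is_derive (fun s => f (c s)) t (dot (grad f (c t)) v).
Proof.
intros Hf Hc Hv.
replace (dot (grad f (c t)) v) with (dirderiv v (ext f) (c t)).
- now apply is_derive_on_sphere.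
- apply dirderiv_V3; now apply smooth_on_sphere_ex_filterdiff.
Qed.

Lemma is_derive_theta f x y : smooth_on_sphere f ->
  is_derive (fun t => f (sph t y)) x (dot (grad f (sph x y)) (e_theta x y)).
Proof.
intros Hf; apply (is_derive_sphere f (fun t => sph t y)); auto using unit_sph.
apply is_derive_sph_l.
Qed.

Lemma is_derive_phi f x y : smooth_on_sphere f ->
  is_derive (fun t => f (sph x t)) y (sin x * dot (grad f (sph x y)) (e_phi x y)).
Proof.
intros Hf; rewrite <- dot_scal_r; apply (is_derive_sphere f (sph x)); auto using unit_sph.
apply is_derive_sph_r.
Qed.

Lemma smooth2_coord_sph k j : smooth2 k (fun x y => coord j (sph x y)).
Proof. destruct j as [|[|[|[|j]]]]; simpl; smooth2_auto. Qed.

Lemma smooth2_sph k f : smooth_on_sphere f -> smooth2 k (fun x y => f (sph x y)).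
Proof.
intros Hf; apply (smooth2_on_sphere (fun j => basis (S j)) 2
  (fun j x y => coord (S j) (sph x y))); auto using unit_sph.
- intros j; apply smooth2_coord_sph.
- intros; apply V3_lin_comb.
Qed.

Lemma smooth2_partial_sph k i f : smooth_on_sphere f ->
  smooth2 k (fun x y => partial i f (sph x y)).
Proof.
intros Hf.
apply (smooth2_ext k (fun x y => partial i f
  (lin_comb (fun j => basis (S j)) 2 (fun j => coord (S j) (sph x y))))).
{ intros x y; now rewrite <- V3_lin_comb. }
apply (smooth2_comp (fun x => x <> zero) (fun j => basis (S j)) 2
  (fun j x y => coord (S j) (sph x y))).
- apply (Hf (S k)).
- intros j; apply smooth2_coord_sph.
- intros x y; rewrite <- V3_lin_comb; apply unit_sphere_neq_zero, unit_sph.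
Qed.

Lemma smooth2_grad_theta k f : smooth_on_sphere f ->
  smooth2 k (fun x y => dot (grad f (sph x y)) (e_theta x y)).
Proof.
intros Hf; pose proof (fun i => smooth2_partial_sph k i f Hf) as HG.
unfold dot, grad, e_theta; cbn [fst snd]; smooth2_auto; apply HG.
Qed.

Lemma smooth2_grad_phi k f : smooth_on_sphere f ->
  smooth2 k (fun x y => dot (grad f (sph x y)) (e_phi x y)).
Proof.
intros Hf; pose proof (fun i => smooth2_partial_sph k i f Hf) as HG.
unfold dot, grad, e_phi; cbn [fst snd]; smooth2_auto; apply HG.
Qed.

Lemma partial_ex_filterdiff f i n : smooth_on_sphere f -> unit_sphere n ->
  ex_filterdiff (partial i f) (locally n).
Proof. intros Hf Hn; apply (proj2 (Hf 2%nat)); now apply unit_sphere_neq_zero. Qed.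

Lemma is_derive_dot (g1 g2 g3 k1 k2 k3 : R -> R) t dg1 dg2 dg3 dk1 dk2 dk3 l :
  is_derive g1 t dg1 -> is_derive g2 t dg2 -> is_derive g3 t dg3 ->
  is_derive k1 t dk1 -> is_derive k2 t dk2 -> is_derive k3 t dk3 ->
  l = dg1 * k1 t + g1 t * dk1 + (dg2 * k2 t + g2 t * dk2) + (dg3 * k3 t + g3 t * dk3) ->
  is_derive (fun t => dot ((g1 t, g2 t), g3 t) ((k1 t, k2 t), k3 t)) t l.
Proof.
intros G1 G2 G3 K1 K2 K3 ->; unfold dot; cbn [fst snd].
assert (M := is_derive_mult (K := R_AbsRing)).
apply (is_derive_plus (fun t => g1 t * k1 t + g2 t * k2 t) (fun t => g3 t * k3 t)).
- apply (is_derive_plus (fun t => g1 t * k1 t) (fun t => g2 t * k2 t));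
    apply M; auto; apply Rmult_comm.
- apply M; auto; apply Rmult_comm.
Qed.

(** A trace may be computed in the orthonormal basis [sph], [e_theta], [e_phi] instead of the
    standard one. The term in [cos x] compensates the motion of the frame: the [y]-derivative of
    [e_phi] is minus the sum of [sin x] times [sph] and [cos x] times [e_theta], and the gradient
    has no component along [sph]. *)
Lemma laplace_spherical f x y : smooth_on_sphere f ->
  sin x * laplace f (sph x y)
  = sin x * Derive (fun t => dot (grad f (sph t y)) (e_theta t y)) x
    + cos x * dot (grad f (sph x y)) (e_theta x y)
    + Derive (fun t => dot (grad f (sph x t)) (e_phi x t)) y.
Proof.
intros Hf.
pose proof (unit_sph x y) as Hn.
assert (H0 : dot (grad f (sph x y)) (sph x y) = 0) by now apply grad_radial.
pose proof (fun i => partial_ex_filterdiff f i _ Hf Hn) as HD.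
(* The Jacobian matrix of the Euclidean gradient of [ext f]. *)
set (M := fun i j => dirderiv (basis j) (partial i f) (sph x y)).
assert (HM : forall i v, dirderiv v (partial i f) (sph x y) = dot ((M i 1%nat, M i 2%nat), M i 3%nat) v)
  by (intros; now apply dirderiv_V3).
assert (Ht : forall i, is_derive (fun t => partial i f (sph t y)) x
  (dot ((M i 1%nat, M i 2%nat), M i 3%nat) (e_theta x y))).
{ intros i; rewrite <- HM; apply (is_derive_dirderiv _ (fun t => sph t y)); auto.
  apply is_derive_sph_l. }
assert (Hp : forall i, is_derive (fun t => partial i f (sph x t)) y
  (sin x * dot ((M i 1%nat, M i 2%nat), M i 3%nat) (e_phi x y))).
{ intros i; rewrite <- dot_scal_r, <- HM; apply (is_derive_dirderiv _ (sph x)); auto.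
  apply is_derive_sph_r. }
assert (HL : forall i, partial i (partial i f) (sph x y)
  = dot ((M i 1%nat, M i 2%nat), M i 3%nat)
      (plus (basis i) (scal (- dot (sph x y) (basis i)) (sph x y)))).
{ intros i; rewrite <- HM; now apply dirderiv_ext_tangential. }
change (laplace f (sph x y)) with (partial 1 (partial 1 f) (sph x y)
  + partial 2 (partial 2 f) (sph x y) + partial 3 (partial 3 f) (sph x y)).
rewrite !HL.
assert (E1 : Derive (fun t => dot (grad f (sph t y)) (e_theta t y)) x =
  (dot ((M 1%nat 1%nat, M 1%nat 2%nat), M 1%nat 3%nat) (e_theta x y) * (cos x * cos y)
   + dot ((M 2%nat 1%nat, M 2%nat 2%nat), M 2%nat 3%nat) (e_theta x y) * (cos x * sin y)
   + dot ((M 3%nat 1%nat, M 3%nat 2%nat), M 3%nat 3%nat) (e_theta x y) * (- sin x)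
   - dot (grad f (sph x y)) (sph x y))).
{ apply is_derive_unique, (is_derive_dot _ _ _ (fun t => cos t * cos y) (fun t => cos t * sin y)
    (fun t => - sin t) x _ _ _ (- sin x * cos y) (- sin x * sin y) (- cos x) _ (Ht _) (Ht _) (Ht _));
    try (auto_derive; auto; ring).
  unfold dot, grad, sph, e_theta; cbn [fst snd]; ring. }
assert (E2 : Derive (fun t => dot (grad f (sph x t)) (e_phi x t)) y =
  (sin x * dot ((M 1%nat 1%nat, M 1%nat 2%nat), M 1%nat 3%nat) (e_phi x y) * (- sin y)
   + sin x * dot ((M 2%nat 1%nat, M 2%nat 2%nat), M 2%nat 3%nat) (e_phi x y) * (cos y)
   - sin x * dot (grad f (sph x y)) (sph x y)
   - cos x * dot (grad f (sph x y)) (e_theta x y))).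
{ apply is_derive_unique, (is_derive_dot _ _ _ (fun t => - sin t) cos (fun _ => 0)
    y _ _ _ (- cos y) (- sin y) 0 _ (Hp _) (Hp _) (Hp _));
    try (auto_derive; auto; ring).
  unfold dot, grad, sph, e_theta, e_phi; cbn [fst snd]; trig_ring x y. }
rewrite E1, E2, H0.
unfold dot, sph, e_theta, e_phi, basis; cbn; unfold plus, scal, mult; cbn.
trig_ring x y.
Qed.

(** A linear form is its own differential, and [ext] replaces [basis j] by its tangential
    projection. *)
Lemma partial_coord i j n : unit_sphere n ->
  partial j (coord i) n = coord i (basis j) - coord j n * coord i n.
Proof.
intros Hn.
assert (Hi : is_linear (coord i : V3 -> R)).
{ destruct i as [|[|[|[|i]]]].
  - exact (is_linear_zero (U := V3) (V := R_NormedModule)).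
  - exact (is_linear_comp (U := V3) _ _ is_linear_fst is_linear_fst).
  - exact (is_linear_comp (U := V3) _ _ is_linear_fst is_linear_snd).
  - exact (is_linear_snd (V := R_NormedModule)).
  - exact (is_linear_zero (U := V3) (V := R_NormedModule)). }
assert (Hd : forall v, dirderiv v (coord i) n = coord i v).
{ intros v; apply is_derive_unique.
  apply (is_derive_comp_curve (coord i) (coord i) (fun t => plus n (scal t v))).
  - now apply filterdiff_linear.
  - apply is_derive_line. }
unfold partial; rewrite dirderiv_ext_tangential, Hd; auto.
- rewrite (linear_plus _ Hi), (linear_scal _ Hi).
  destruct n as [[n1 n2] n3]; to_R.
  destruct j as [|[|[|[|j]]]]; unfold dot; cbn; unfold plus, scal, mult; cbn; try ring.
- eexists; now apply filterdiff_linear.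
Qed.

(** The gradient of x_i is the tangential part of a basis vector and that of [h] is tangent, so the
    product is the i-th coordinate of grad h, which is then expanded in the frame. Each time a
    multiple of the vanishing radial component is added first, to reach a polynomial identity. *)
Lemma dot_grad_coord h i x y : smooth_on_sphere h -> (1 <= i <= 3)%nat ->
  dot (grad h (sph x y)) (grad (coord i) (sph x y))
  = dot (grad h (sph x y)) (e_theta x y) * coord i (e_theta x y)
    + dot (grad h (sph x y)) (e_phi x y) * coord i (e_phi x y).
Proof.
intros Hh Hi.
pose proof (grad_radial h _ Hh (unit_sph x y)) as H0.
assert (E : dot (grad h (sph x y)) (grad (coord i) (sph x y)) = coord i (grad h (sph x y))).
{ unfold grad at 2; rewrite !partial_coord by apply unit_sph.
  transitivity (coord i (grad h (sph x y))
    - coord i (sph x y) * dot (grad h (sph x y)) (sph x y)); [|rewrite H0; ring].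
  destruct i as [|[|[|[|i]]]]; try lia; unfold dot; cbn; ring. }
rewrite E.
transitivity (coord i (grad h (sph x y))
  - coord i (sph x y) * dot (grad h (sph x y)) (sph x y)); [rewrite H0; ring|].
destruct i as [|[|[|[|i]]]]; try lia;
  unfold dot, grad, sph, e_theta, e_phi; cbn [fst snd coord]; trig_ring x y.
Qed.

(** * Spinors in the spherical spin frame *)

Definition basis4 (j : nat) : V4 :=
  match j with
  | 0%nat => ((1, 0), (0, 0))
  | 1%nat => ((0, 1), (0, 0))
  | 2%nat => ((0, 0), (1, 0))
  | _ => ((0, 0), (0, 1))
  end.

Definition coord4 (j : nat) (g : V4) : R :=
  match j with
  | 0%nat => fst (fst g)
  | 1%nat => snd (fst g)
  | 2%nat => fst (snd g)
  | _ => snd (snd g)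
  end.

Lemma V4_lin_comb (g : V4) : g = lin_comb basis4 3 (fun j => coord4 j g).
Proof.
unfold lin_comb; rewrite !sum_Sn, sum_O; destruct g as [[a1 a2] [b1 b2]]; coord_ring.
Qed.

Lemma is_derive_V4 (c1 c2 c3 c4 : R -> R) t d1 d2 d3 d4 :
  is_derive c1 t d1 -> is_derive c2 t d2 -> is_derive c3 t d3 -> is_derive c4 t d4 ->
  is_derive (fun s => ((c1 s, c2 s), (c3 s, c4 s)) : V4) t ((d1, d2), (d3, d4)).
Proof.
intros H1 H2 H3 H4.
rewrite (V4_lin_comb ((d1, d2), (d3, d4))).
apply (is_derive_ext (fun s => lin_comb basis4 3
  (fun j => coord4 j ((c1 s, c2 s), (c3 s, c4 s))))).
- intros; symmetry; apply V4_lin_comb.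
- apply (is_derive_lin_comb _ _ (fun j s => coord4 j ((c1 s, c2 s), (c3 s, c4 s)))).
  intros [|[|[|j]]]; auto.
Qed.

(* [frame1] and [frame2] of this lift are [e_theta] and [e_phi]. *)
Definition spin_frame (x y : R) : V4 :=
  ((cos (x / 2) * cos (y / 2), - (cos (x / 2) * sin (y / 2))),
   (sin (x / 2) * cos (y / 2), sin (x / 2) * sin (y / 2))).

Lemma unit_spin_frame x y : unit_sphere (spin_frame x y).
Proof. apply unit_V4; cbn [fst snd]; trig_ring (x / 2) (y / 2). Qed.

Lemma base_spin_frame x y : base (spin_frame x y) = sph x y.
Proof.
destruct (half_angle x) as (Hcx & Hsx & _), (half_angle y) as (Hcy & Hsy & _).
unfold sph; rewrite Hcx, Hsx, Hcy, Hsy; unfold spin_frame; su2_unfold.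
repeat apply injective_projections; cbn; trig_ring (x / 2) (y / 2).
Qed.

Lemma smooth2_spin_frame k (f : V4 -> R) : smooth_on_sphere f ->
  smooth2 k (fun x y => f (spin_frame x y)).
Proof.
intros Hf; apply (smooth2_on_sphere basis4 3 (fun j x y => coord4 j (spin_frame x y)));
  auto using unit_spin_frame.
- intros [|[|[|j]]]; simpl; smooth2_auto.
- intros; apply V4_lin_comb.
Qed.

(** Meridians are geodesics and ([e_theta], [e_phi]) is parallel along them, so in this frame the
    covariant derivative along [e_theta] is the plain derivative in [x]. *)
Lemma spin_frame_transport x y t :
  su2_mul (spin_frame x y) (transport (RtoC 1) t) = spin_frame (x + t) y.
Proof.
unfold spin_frame; replace ((x + t) / 2) with (x / 2 + t / 2) by field.
rewrite cos_plus, sin_plus; su2_unfold; repeat apply injective_projections; cbn; ring.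
Qed.

Lemma unit_transport_Ci g t : unit_sphere g -> unit_sphere (su2_mul g (transport Ci t)).
Proof.
destruct g as [[a1 a2] [b1 b2]]; intros H; apply unit_V4 in H; su2_unfold.
apply unit_V4; cbn [fst snd]; refine (eq_trans _ H); ring [(sin_sqr (t / 2))].
Qed.

(** This is exp(i t / 2): [spin2 (circle t)] turns the frame by the angle - t. *)
Definition circle (t : R) : C := (cos (t / 2), sin (t / 2)).

Lemma Cmod_circle t : Cmod (circle t) = 1.
Proof.
unfold Cmod, circle; cbn [fst snd]; replace (_ + _) with 1 by ring [(sin_sqr (t / 2))].
apply sqrt_1.
Qed.

Lemma unit_spin2_circle g t : unit_sphere g -> unit_sphere (su2_mul g (spin2 (circle t))).
Proof.
destruct g as [[a1 a2] [b1 b2]]; intros H; apply unit_V4 in H; unfold circle; su2_unfold.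
apply unit_V4; cbn [fst snd]; refine (eq_trans _ H); ring [(sin_sqr (t / 2))].
Qed.

(* The coordinate field d/dphi lifts to sin(theta) times the horizontal lift of
   e_phi, minus cos(theta) times the generator of the right action of Spin(2). *)
Lemma Derive_spin_frame_phi (f : V4 -> R) x y : smooth_on_sphere f ->
  Derive (fun t => f (spin_frame x t)) y
  = sin x * Derive (fun t => f (su2_mul (spin_frame x y) (transport Ci t))) 0
    - cos x * Derive (fun t => f (su2_mul (spin_frame x y) (spin2 (circle t)))) 0.
Proof.
intros Hf; pose proof (unit_spin_frame x y) as Hg; set (g := spin_frame x y) in *.
pose proof (smooth_on_sphere_ex_filterdiff f g Hf Hg) as HD.
destruct (filterdiff_dirderiv _ _ HD) as [Hl _].
assert (H0 : cos (0 / 2) = 1 /\ sin (0 / 2) = 0)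
  by (replace (0 / 2) with 0 by field; split; [apply cos_0|apply sin_0]).
destruct H0 as [C0 S0].
set (c := cos (x / 2)) in *; set (s := sin (x / 2)) in *.
set (c' := cos (y / 2)) in *; set (s' := sin (y / 2)) in *.
(* Velocities at [g] of the coordinate line of [y], of the horizontal curve along [e_phi] and of the
   Spin(2) orbit. The half-angle formulas relate the three. *)
set (v1 := ((- (c * s') / 2, - (c * c') / 2), (- (s * s') / 2, s * c' / 2)) : V4).
set (v2 := ((- (s * s') / 2, - (s * c') / 2), (- (c * s') / 2, c * c' / 2)) : V4).
set (v3 := ((c * s' / 2, c * c' / 2), (- (s * s') / 2, s * c' / 2)) : V4).
assert (D1 : Derive (fun t => f (spin_frame x t)) y = dirderiv v1 (ext f) g).
{ apply is_derive_unique.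
  apply (is_derive_on_sphere f (spin_frame x)); auto using unit_spin_frame.
  apply is_derive_V4; auto_derive; auto; fold (y / 2); unfold c, s, c', s'; field. }
assert (D2 : Derive (fun t => f (su2_mul g (transport Ci t))) 0 = dirderiv v2 (ext f) g).
{ apply is_derive_unique.
  apply (is_derive_on_sphere f (fun t => su2_mul g (transport Ci t))); auto using unit_transport_Ci.
  { destruct g as [[a1 a2] [b1 b2]]; su2_unfold; rewrite C0, S0.
    repeat apply injective_projections; cbn; ring. }
  unfold g, spin_frame; su2_unfold.
  apply is_derive_V4; auto_derive; auto; fold (0 / 2); rewrite C0, S0; unfold c, s, c', s'; field. }
assert (D3 : Derive (fun t => f (su2_mul g (spin2 (circle t)))) 0 = dirderiv v3 (ext f) g).
{ apply is_derive_unique.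
  apply (is_derive_on_sphere f (fun t => su2_mul g (spin2 (circle t)))); auto using unit_spin2_circle.
  { destruct g as [[a1 a2] [b1 b2]]; unfold circle; su2_unfold; rewrite C0, S0.
    repeat apply injective_projections; cbn; ring. }
  unfold g, spin_frame, circle; su2_unfold.
  apply is_derive_V4; auto_derive; auto; fold (0 / 2); rewrite C0, S0; unfold c, s, c', s'; field. }
rewrite D1, D2, D3.
replace v1 with (plus (scal (sin x) v2) (scal (- cos x) v3) : V4).
- rewrite (linear_plus _ Hl), !(linear_scal _ Hl); cbn; unfold mult; cbn; ring.
- destruct (half_angle x) as (Hc & Hs & _); rewrite Hc, Hs; fold c s.
  unfold v1, v2, v3; repeat apply injective_projections; cbn; unfold plus, scal; cbn;
    unfold mult; cbn; pose proof (sin_sqr (x / 2)) as E; fold c s in E; field [E].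
Qed.

Lemma spinor_norm2_at_sph psi x y : equivariant psi ->
  spinor_norm2_at psi (sph x y) = spinor_norm2 (psi (spin_frame x y)).
Proof.
intros He.
destruct (base_spin_frame_above (sph x y) (unit_sph x y)) as [Hu Hb].
destruct (base_fiber (spin_frame x y) (spin_frame_above (sph x y))) as (w & Hw & E);
  auto using unit_spin_frame.
- now rewrite Hb, base_spin_frame.
- unfold spinor_norm2_at; rewrite E; now apply equivariant_norm2; auto using unit_spin_frame.
Qed.

(** After one circuit in [y] the frame comes back, but its lift is multiplied by -1 in Spin(2). *)
Lemma spin_frame_2PI psi x y : equivariant psi ->
  psi (spin_frame x (y + 2 * PI)) = spinor_scal (-1) (psi (spin_frame x y)).
Proof.
intros He.
replace (spin_frame x (y + 2 * PI)) with (su2_mul (spin_frame x y) (spin2 (RtoC (-1)))).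
- rewrite He; [|apply unit_spin_frame|].
  + su2_unfold; repeat apply injective_projections; cbn; ring.
  + unfold Cmod, RtoC; cbn [fst snd]; replace (_ + _) with 1 by ring; apply sqrt_1.
- unfold spin_frame; replace ((y + 2 * PI) / 2) with (y / 2 + PI) by field.
  rewrite neg_cos, neg_sin; su2_unfold; repeat apply injective_projections; cbn; ring.
Qed.

Lemma Derive_shift (f : R -> R) x : Derive (fun s => f (x + s)) 0 = Derive f x.
Proof.
unfold Derive; f_equal; apply Lim_ext; intros h.
now rewrite Rplus_0_r, Rplus_0_l.
Qed.

(** Clifford multiplication by [e_phi] is invertible, so the Dirac equation determines the
    derivative along [e_phi] from the one along [e_theta]. The terms in [cos x] are the spin
    connection form; they come from the derivative along the Spin(2) orbit. *)
Lemma dirac_spherical psi x y lambda : smooth_spinor psi ->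
  dirac psi (spin_frame x y) = spinor_scal lambda (psi (spin_frame x y)) ->
  let a1 x y := fst (fst (psi (spin_frame x y))) in
  let a2 x y := snd (fst (psi (spin_frame x y))) in
  let b1 x y := fst (snd (psi (spin_frame x y))) in
  let b2 x y := snd (snd (psi (spin_frame x y))) in
  Derive (a1 x) y = sin x * (- lambda * b1 x y - Derive (fun t => a2 t y) x) - cos x * (a2 x y / 2) /\
  Derive (a2 x) y = sin x * (- lambda * b2 x y + Derive (fun t => a1 t y) x) + cos x * (a1 x y / 2) /\
  Derive (b1 x) y = sin x * (lambda * a1 x y + Derive (fun t => b2 t y) x) + cos x * (b2 x y / 2) /\
  Derive (b2 x) y = sin x * (lambda * a2 x y - Derive (fun t => b1 t y) x) - cos x * (b1 x y / 2).
Proof.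
intros (He & S1 & S2 & S3 & S4) HD; cbv beta zeta.
pose proof (unit_spin_frame x y) as Hg.
rewrite (Derive_spin_frame_phi _ x y S1), (Derive_spin_frame_phi _ x y S2),
  (Derive_spin_frame_phi _ x y S3), (Derive_spin_frame_phi _ x y S4).
rewrite <- (Derive_shift (fun t => fst (fst (psi (spin_frame t y)))) x),
  <- (Derive_shift (fun t => snd (fst (psi (spin_frame t y)))) x),
  <- (Derive_shift (fun t => fst (snd (psi (spin_frame t y)))) x),
  <- (Derive_shift (fun t => snd (snd (psi (spin_frame t y)))) x).
assert (N1 : nabla (RtoC 1) psi (spin_frame x y) =
  ((Derive (fun s => fst (fst (psi (spin_frame (x + s) y)))) 0,
    Derive (fun s => snd (fst (psi (spin_frame (x + s) y)))) 0),
   (Derive (fun s => fst (snd (psi (spin_frame (x + s) y)))) 0,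
    Derive (fun s => snd (snd (psi (spin_frame (x + s) y)))) 0))).
{ unfold nabla, Cderive; repeat apply injective_projections; cbn [fst snd];
    apply Derive_ext; intros t; now rewrite spin_frame_transport. }
(* Equivariance makes psi explicit along the Spin(2) orbit, so the derivatives there are algebraic:
   half of a component, up to sign. *)
assert (V : forall t, psi (su2_mul (spin_frame x y) (spin2 (circle t)))
  = spin_rep (Cconj (circle t)) (psi (spin_frame x y)))
  by (intros; apply He; auto using Cmod_circle).
assert (C0 : cos (0 / 2) = 1) by (replace (0 / 2) with 0 by field; apply cos_0).
assert (S0 : sin (0 / 2) = 0) by (replace (0 / 2) with 0 by field; apply sin_0).
unfold dirac in HD; rewrite N1 in HD; clear N1.
unfold nabla, Cderive in HD.
set (g := spin_frame x y) in *.
set (A1 := Derive (fun s => fst (fst (psi (spin_frame (x + s) y)))) 0) in *.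
set (A2 := Derive (fun s => snd (fst (psi (spin_frame (x + s) y)))) 0) in *.
set (B1 := Derive (fun s => fst (snd (psi (spin_frame (x + s) y)))) 0) in *.
set (B2 := Derive (fun s => snd (snd (psi (spin_frame (x + s) y)))) 0) in *.
set (T1 := Derive (fun s => fst (fst (psi (su2_mul g (transport Ci s))))) 0) in *.
set (T2 := Derive (fun s => snd (fst (psi (su2_mul g (transport Ci s))))) 0) in *.
set (T3 := Derive (fun s => fst (snd (psi (su2_mul g (transport Ci s))))) 0) in *.
set (T4 := Derive (fun s => snd (snd (psi (su2_mul g (transport Ci s))))) 0) in *.
destruct (psi g) as [[p1 p2] [q1 q2]].
assert (V1 : Derive (fun t => fst (fst (psi (su2_mul g (spin2 (circle t)))))) 0 = p2 / 2).
{ apply is_derive_unique; apply (is_derive_ext (fun t => cos (t / 2) * p1 + sin (t / 2) * p2)).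
  - intros t; rewrite V; unfold circle; su2_unfold; R_eq; ring.
  - auto_derive; auto; fold (0 / 2); rewrite C0, S0; field. }
assert (V2 : Derive (fun t => snd (fst (psi (su2_mul g (spin2 (circle t)))))) 0 = - p1 / 2).
{ apply is_derive_unique; apply (is_derive_ext (fun t => cos (t / 2) * p2 - sin (t / 2) * p1)).
  - intros t; rewrite V; unfold circle; su2_unfold; R_eq; ring.
  - auto_derive; auto; fold (0 / 2); rewrite C0, S0; field. }
assert (V3 : Derive (fun t => fst (snd (psi (su2_mul g (spin2 (circle t)))))) 0 = - q2 / 2).
{ apply is_derive_unique; apply (is_derive_ext (fun t => cos (t / 2) * q1 - sin (t / 2) * q2)).
  - intros t; rewrite V; unfold circle; su2_unfold; R_eq; ring.
  - auto_derive; auto; fold (0 / 2); rewrite C0, S0; field. }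
assert (V5 : Derive (fun t => snd (snd (psi (su2_mul g (spin2 (circle t)))))) 0 = q1 / 2).
{ apply is_derive_unique; apply (is_derive_ext (fun t => cos (t / 2) * q2 + sin (t / 2) * q1)).
  - intros t; rewrite V; unfold circle; su2_unfold; R_eq; ring.
  - auto_derive; auto; fold (0 / 2); rewrite C0, S0; field. }
rewrite V1, V2, V3, V5; cbn [fst snd].
clearbody A1 A2 B1 B2 T1 T2 T3 T4.
unfold gamma1, gamma2, spinor_add, spinor_scal, Cmult, Cplus, Copp, Ci, RtoC in HD; cbn [fst snd] in HD.
injection HD; clear HD; intros E4 E3 E2 E1.
(* Real and imaginary parts of the two components of the Dirac equation, solved for the derivatives
   along [e_phi]. *)
replace T1 with (- lambda * q1 - A2) by lra.
replace T2 with (- lambda * q2 + A1) by lra.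
replace T3 with (lambda * p1 + B2) by lra.
replace T4 with (lambda * p2 - B1) by lra.
split4; field.
Qed.

(** * Energy-momentum of the spinor and the Kazdan-Warner identity *)

Definition d_theta (F : R -> R -> R) (x y : R) : R := Derive (fun t => F t y) x.
Definition d_phi (F : R -> R -> R) (x y : R) : R := Derive (fun t => F x t) y.

Definition norm2_in (a1 a2 b1 b2 : R -> R -> R) (x y : R) : R :=
  a1 x y ^ 2 + a2 x y ^ 2 + b1 x y ^ 2 + b2 x y ^ 2.

(* The components <e_theta . nabla_theta psi, psi> and
   <e_theta . nabla_phi psi, psi> = <e_phi . nabla_theta psi, psi> of the
   energy-momentum tensor, whose trace is <D psi, psi>. *)
Definition stress11 (a1 a2 b1 b2 : R -> R -> R) (x y : R) : R :=
  d_theta a1 x y * b2 x y - d_theta a2 x y * b1 x y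
  + d_theta b1 x y * a2 x y - d_theta b2 x y * a1 x y.
Definition stress12 (a1 a2 b1 b2 : R -> R -> R) (x y : R) : R :=
  d_theta b1 x y * a1 x y + d_theta b2 x y * a2 x y
  - d_theta a1 x y * b1 x y - d_theta a2 x y * b2 x y.

Lemma smooth2_d_theta k F : smooth2 (S k) F -> smooth2 k (d_theta F).
Proof. apply smooth2_Derive_l. Qed.

Lemma smooth2_d_phi k F : smooth2 (S k) F -> smooth2 k (d_phi F).
Proof. apply smooth2_Derive_r. Qed.

Lemma smooth2_is_derive_l k F x y :
  smooth2 (S k) F -> is_derive (fun t => F t y) x (d_theta F x y).
Proof. intros H; now apply (smooth2_Derive_l k). Qed.

Lemma smooth2_is_derive_r k F x y :
  smooth2 (S k) F -> is_derive (fun t => F x t) y (d_phi F x y).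
Proof. intros H; now apply (smooth2_Derive_r k). Qed.

Lemma smooth2_mixed k F x y : smooth2 (S (S k)) F ->
  d_phi (d_theta F) x y = d_theta (d_phi F) x y.
Proof.
intros H.
assert (H1 := smooth2_d_theta _ _ H); assert (H2 := smooth2_d_phi _ _ H).
apply (mixed_partials F (d_theta F) (d_phi F)); intros.
- eapply smooth2_is_derive_l; eauto.
- eapply smooth2_is_derive_r; eauto.
- eapply smooth2_is_derive_r; eauto.
- eapply smooth2_is_derive_l; eauto.
- eapply smooth2_continuity, smooth2_d_phi; eauto.
- eapply smooth2_continuity, smooth2_d_theta; eauto.
Qed.

(** The side conditions of [auto_derive] are met by [smooth2] facts of order at least 1, which the
    proofs below keep in the context for every function to be differentiated. *)
Ltac solve_ex_derive :=
  repeat match goal with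
  | |- _ /\ _ => split
  | |- True => exact I
  | |- ex_derive (fun t => ?F t ?y) ?x =>
      eexists; eapply (smooth2_is_derive_l _ F x y); eassumption
  | |- ex_derive (fun t => ?F ?x t) ?y =>
      eexists; eapply (smooth2_is_derive_r _ F x y); eassumption
  end.

Ltac fold_partials :=
  repeat match goal with
  | |- context [Derive (fun t => ?F t ?y) ?x] =>
      change (Derive (fun t => F t y) x) with (d_theta F x y)
  | |- context [Derive (fun t => ?F ?x t) ?y] =>
      change (Derive (fun t => F x t) y) with (d_phi F x y)
  end.

Ltac compute_partial :=
  apply is_derive_unique; auto_derive; [solve_ex_derive|fold_partials].

(** The conclusions are the two frame components of the divergence of T_psi, multiplied by [sin x];
    the trace makes F N - J the last entry of the tensor. Once the Dirac equation has removed all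
    [y]-derivatives of the spinor components, both are polynomial identities modulo the relation
    between sine and cosine. *)
Lemma dirac_energy_momentum (F a1 a2 b1 b2 : R -> R -> R) :
  smooth2 1 F -> smooth2 2 a1 -> smooth2 2 a2 -> smooth2 2 b1 -> smooth2 2 b2 ->
  (forall x y, d_phi a1 x y
    = sin x * (- F x y * b1 x y - d_theta a2 x y) - cos x * (a2 x y / 2)) ->
  (forall x y, d_phi a2 x y
    = sin x * (- F x y * b2 x y + d_theta a1 x y) + cos x * (a1 x y / 2)) ->
  (forall x y, d_phi b1 x y
    = sin x * (F x y * a1 x y + d_theta b2 x y) + cos x * (b2 x y / 2)) ->
  (forall x y, d_phi b2 x y
    = sin x * (F x y * a2 x y - d_theta b1 x y) - cos x * (b1 x y / 2)) ->
  let J := stress11 a1 a2 b1 b2 in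
  let K := stress12 a1 a2 b1 b2 in
  let N := norm2_in a1 a2 b1 b2 in
  forall x y,
  sin x * d_theta J x y + cos x * J x y + d_phi K x y - cos x * (F x y * N x y - J x y)
  = sin x * N x y * d_theta F x y /\
  sin x * d_theta K x y + 2 * cos x * K x y
  + (d_phi F x y * N x y + F x y * d_phi N x y - d_phi J x y)
  = N x y * d_phi F x y.
Proof.
intros SF S1 S2 S3 S4 E1 E2 E3 E4 J K N x y.
assert (S1t := smooth2_d_theta _ _ S1); assert (S2t := smooth2_d_theta _ _ S2).
assert (S3t := smooth2_d_theta _ _ S3); assert (S4t := smooth2_d_theta _ _ S4).
(* Mixed derivatives: exchange the two, then differentiate the Dirac equation in [x]. *)
assert (M1 : d_phi (d_theta a1) x y = cos x * (- F x y * b1 x y - d_theta a2 x y)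
  + sin x * (- d_theta F x y * b1 x y - F x y * d_theta b1 x y - d_theta (d_theta a2) x y)
  + sin x * (a2 x y / 2) - cos x * (d_theta a2 x y / 2)).
{ rewrite (smooth2_mixed 0) by assumption; unfold d_theta at 1.
  rewrite (Derive_ext _ _ x (fun t => E1 t y)); compute_partial; field. }
assert (M2 : d_phi (d_theta a2) x y = cos x * (- F x y * b2 x y + d_theta a1 x y)
  + sin x * (- d_theta F x y * b2 x y - F x y * d_theta b2 x y + d_theta (d_theta a1) x y)
  - sin x * (a1 x y / 2) + cos x * (d_theta a1 x y / 2)).
{ rewrite (smooth2_mixed 0) by assumption; unfold d_theta at 1.
  rewrite (Derive_ext _ _ x (fun t => E2 t y)); compute_partial; field. }
assert (M3 : d_phi (d_theta b1) x y = cos x * (F x y * a1 x y + d_theta b2 x y)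
  + sin x * (d_theta F x y * a1 x y + F x y * d_theta a1 x y + d_theta (d_theta b2) x y)
  - sin x * (b2 x y / 2) + cos x * (d_theta b2 x y / 2)).
{ rewrite (smooth2_mixed 0) by assumption; unfold d_theta at 1.
  rewrite (Derive_ext _ _ x (fun t => E3 t y)); compute_partial; field. }
assert (M4 : d_phi (d_theta b2) x y = cos x * (F x y * a2 x y - d_theta b1 x y)
  + sin x * (d_theta F x y * a2 x y + F x y * d_theta a2 x y - d_theta (d_theta b1) x y)
  + sin x * (b1 x y / 2) - cos x * (d_theta b1 x y / 2)).
{ rewrite (smooth2_mixed 0) by assumption; unfold d_theta at 1.
  rewrite (Derive_ext _ _ x (fun t => E4 t y)); compute_partial; field. }
assert (J1 : d_theta J x y = d_theta (d_theta a1) x y * b2 x y - d_theta (d_theta a2) x y * b1 x y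
  + d_theta (d_theta b1) x y * a2 x y - d_theta (d_theta b2) x y * a1 x y).
{ unfold d_theta at 1; unfold J, stress11; compute_partial; ring. }
assert (J2 : d_phi J x y = d_phi (d_theta a1) x y * b2 x y + d_theta a1 x y * d_phi b2 x y
  - d_phi (d_theta a2) x y * b1 x y - d_theta a2 x y * d_phi b1 x y
  + d_phi (d_theta b1) x y * a2 x y + d_theta b1 x y * d_phi a2 x y
  - d_phi (d_theta b2) x y * a1 x y - d_theta b2 x y * d_phi a1 x y).
{ unfold d_phi at 1; unfold J, stress11; compute_partial; ring. }
assert (K1 : d_theta K x y = d_theta (d_theta b1) x y * a1 x y + d_theta (d_theta b2) x y * a2 x y
  - d_theta (d_theta a1) x y * b1 x y - d_theta (d_theta a2) x y * b2 x y).
{ unfold d_theta at 1; unfold K, stress12; compute_partial; ring. }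
assert (K2 : d_phi K x y = d_phi (d_theta b1) x y * a1 x y + d_theta b1 x y * d_phi a1 x y
  + d_phi (d_theta b2) x y * a2 x y + d_theta b2 x y * d_phi a2 x y
  - d_phi (d_theta a1) x y * b1 x y - d_theta a1 x y * d_phi b1 x y
  - d_phi (d_theta a2) x y * b2 x y - d_theta a2 x y * d_phi b2 x y).
{ unfold d_phi at 1; unfold K, stress12; compute_partial; ring. }
assert (N2 : d_phi N x y = 2 * (a1 x y * d_phi a1 x y + a2 x y * d_phi a2 x y
  + b1 x y * d_phi b1 x y + b2 x y * d_phi b2 x y)).
{ assert (smooth2 1 a1 /\ smooth2 1 a2 /\ smooth2 1 b1 /\ smooth2 1 b2) as (? & ? & ? & ?)
    by auto using smooth2_pred.
  unfold d_phi at 1; unfold N, norm2_in; compute_partial; ring. }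
rewrite J1, J2, K1, K2, N2, M1, M2, M3, M4, E1, E2, E3, E4.
unfold J, K, N, stress11, stress12, norm2_in.
split; field [(sin_sqr x)].
Qed.

(** Here [X] is x_i, ([X1], [Y]) are the components of its gradient, ([p], [q]) those of grad u,
    ([m1], [r1]) and ([m2], [r2]) those of grad h_1 and grad h_2. The equations for the derivatives
    of [X1] and [Y] express that the Hessian of x_i is - x_i g_0. *)
Lemma kazdan_warner_chart (X X1 Y U p q h1 m1 r1 h2 m2 r2 a1 a2 b1 b2 : R -> R -> R) :
  smooth2 3 X -> smooth2 3 X1 -> smooth2 3 Y -> smooth2 3 U -> smooth2 3 p -> smooth2 3 q ->
  smooth2 3 h1 -> smooth2 3 h2 ->
  smooth2 3 a1 -> smooth2 3 a2 -> smooth2 3 b1 -> smooth2 3 b2 ->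
  (forall x y, d_theta X x y = X1 x y) ->
  (forall x y, d_phi X x y = sin x * Y x y) ->
  (forall x y, d_theta X1 x y = - X x y) ->
  (forall x y, d_phi X1 x y = cos x * Y x y) ->
  (forall x y, d_theta Y x y = 0) ->
  (forall x y, d_phi Y x y = - (sin x * X x y + cos x * X1 x y)) ->
  (forall x y, d_theta U x y = p x y) ->
  (forall x y, d_phi U x y = sin x * q x y) ->
  (forall x y, d_theta h1 x y = m1 x y) ->
  (forall x y, d_phi h1 x y = sin x * r1 x y) ->
  (forall x y, d_theta h2 x y = m2 x y) ->
  (forall x y, d_phi h2 x y = sin x * r2 x y) ->
  let F := fun x y => h2 x y * exp (U x y) in
  let N := norm2_in a1 a2 b1 b2 in
  (forall x y, sin x * d_theta p x y + cos x * p x y + d_phi q x y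
    = - sin x * (h1 x y * exp (2 * U x y) - 1 + F x y * N x y)) ->
  (forall x y, d_phi a1 x y
    = sin x * (- F x y * b1 x y - d_theta a2 x y) - cos x * (a2 x y / 2)) ->
  (forall x y, d_phi a2 x y
    = sin x * (- F x y * b2 x y + d_theta a1 x y) + cos x * (a1 x y / 2)) ->
  (forall x y, d_phi b1 x y
    = sin x * (F x y * a1 x y + d_theta b2 x y) + cos x * (b2 x y / 2)) ->
  (forall x y, d_phi b2 x y
    = sin x * (F x y * a2 x y - d_theta b1 x y) - cos x * (b1 x y / 2)) ->
  (forall G, List.In G (X :: X1 :: Y :: U :: p :: q :: h1 :: h2 :: nil)%list ->
     forall x, G x (2 * PI) = G x 0) ->
  (forall G, List.In G (a1 :: a2 :: b1 :: b2 :: nil)%list ->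
     forall x, G x (2 * PI) = - G x 0) ->
  RInt (fun y => RInt (fun x =>
    sin x * ((m1 x y * X1 x y + r1 x y * Y x y) * exp (2 * U x y) / 2
             + (m2 x y * X1 x y + r2 x y * Y x y) * exp (U x y) * N x y)) 0 PI) 0 (2 * PI) = 0.
Proof.
intros SX SX1 SY SU Sp Sq Sh1 Sh2 Sa1 Sa2 Sb1 Sb2
  X_t X_f X1_t X1_f Y_t Y_f U_t U_f h1_t h1_f h2_t h2_f F N HL E1 E2 E3 E4 Per Anti.
assert (SF : smooth2 3 F) by (unfold F; smooth2_auto).
set (J := stress11 a1 a2 b1 b2); set (K := stress12 a1 a2 b1 b2).
assert (SJ : smooth2 2 J) by (unfold J, stress11; smooth2_auto;
  auto using smooth2_pred, smooth2_d_theta).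
assert (SK : smooth2 2 K) by (unfold K, stress12; smooth2_auto;
  auto using smooth2_pred, smooth2_d_theta).
assert (SN : smooth2 3 N) by (unfold N, norm2_in; smooth2_auto).
pose proof (dirac_energy_momentum F a1 a2 b1 b2) as HT; cbv zeta in HT.
fold J K N in HT.
assert (HT' := HT ltac:(auto using smooth2_pred) ltac:(auto using smooth2_pred)
  ltac:(auto using smooth2_pred) ltac:(auto using smooth2_pred)
  ltac:(auto using smooth2_pred) E1 E2 E3 E4); clear HT; rename HT' into HT.
(* For T = du du - |du|^2/2 + (h1 e^{2u} - 1)/2 + (spinor stress), this is the
   vector field T(grad x_i) - x_i grad u. *)
set (V := fun x y => X1 x y * ((p x y ^ 2 - q x y ^ 2) / 2 + h1 x y * exp (2 * U x y) / 2 - 1 / 2 + J x y)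
  + Y x y * (p x y * q x y + K x y) - X x y * p x y).
set (W := fun x y => X1 x y * (p x y * q x y + K x y)
  + Y x y * ((q x y ^ 2 - p x y ^ 2) / 2 + h1 x y * exp (2 * U x y) / 2 - 1 / 2 + F x y * N x y - J x y)
  - X x y * q x y).
assert (SV : smooth2 2 V) by (unfold V; smooth2_auto; auto using smooth2_pred).
assert (SW : smooth2 2 W) by (unfold W; smooth2_auto; auto using smooth2_pred).
(* Symmetry of the Hessian of u, from the exchange of derivatives of [U]. *)
assert (p_f : forall x y, d_phi p x y = sin x * d_theta q x y + cos x * q x y).
{ intros x y; unfold d_phi.
  rewrite (Derive_ext _ (d_theta U x)) by (intros; symmetry; apply U_t).
  change (d_phi (d_theta U) x y = sin x * d_theta q x y + cos x * q x y).
  rewrite (smooth2_mixed 1) by assumption; unfold d_theta at 1.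
  rewrite (Derive_ext _ _ x (fun t => U_f t y)); compute_partial; ring. }
assert (F_t : forall x y, d_theta F x y = (m2 x y + h2 x y * p x y) * exp (U x y)).
{ intros x y; unfold d_theta, F; compute_partial; rewrite U_t, h2_t; ring. }
assert (F_f : forall x y, d_phi F x y = sin x * (r2 x y + h2 x y * q x y) * exp (U x y)).
{ intros x y; unfold d_phi, F; compute_partial; rewrite U_f, h2_f; ring. }
refine (eq_trans _ (divergence_theorem (fun x y => sin x * V x y)
  (d_theta (fun x y => sin x * V x y)) W (d_phi W) 0 PI 0 (2 * PI) _ _ _ _ _ _)).
- apply RInt_ext; intros y _; apply RInt_ext; intros x _.
  assert (DV : d_theta (fun x y => sin x * V x y) x y = cos x * V x y
    + sin x * (X1 x y * (p x y * d_theta p x y - q x y * d_theta q x y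
          + m1 x y * exp (2 * U x y) / 2 + h1 x y * p x y * exp (2 * U x y) + d_theta J x y)
        - X x y * ((p x y ^ 2 - q x y ^ 2) / 2 + h1 x y * exp (2 * U x y) / 2 - 1 / 2 + J x y)
        + Y x y * (d_theta p x y * q x y + p x y * d_theta q x y + d_theta K x y)
        - X1 x y * p x y - X x y * d_theta p x y)).
  { unfold d_theta at 1; unfold V; compute_partial.
    rewrite X_t, X1_t, Y_t, U_t, h1_t; field. }
  assert (DW : d_phi W x y = cos x * Y x y * (p x y * q x y + K x y)
    + X1 x y * (d_phi p x y * q x y + p x y * d_phi q x y + d_phi K x y)
    - (sin x * X x y + cos x * X1 x y) * ((q x y ^ 2 - p x y ^ 2) / 2
        + h1 x y * exp (2 * U x y) / 2 - 1 / 2 + F x y * N x y - J x y)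
    + Y x y * (q x y * d_phi q x y - p x y * d_phi p x y
        + sin x * r1 x y * exp (2 * U x y) / 2 + h1 x y * sin x * q x y * exp (2 * U x y)
        + d_phi F x y * N x y + F x y * d_phi N x y - d_phi J x y)
    - sin x * Y x y * q x y - X x y * d_phi q x y).
  { unfold d_phi at 1; unfold W; compute_partial.
    rewrite X_f, X1_f, Y_f, U_f, h1_f; field. }
  rewrite DV, DW.
  destruct (HT x y) as [T1 T2]; specialize (HL x y).
  rewrite F_t in T1; rewrite p_f.
  (* [Z1] is the scalar equation, [Z2] and [Z3] are the two components of the spinor identity, each
     as an expression equal to 0. The multiplier of [Z1] is du(grad x_i) - x_i, which collects Delta
     u from both parts of the field; those of [Z2] and [Z3] are the components of grad x_i, against
     which the divergence of T_psi is contracted. *)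
  pose (Z1 := sin x * d_theta p x y + cos x * p x y + d_phi q x y
    + sin x * (h1 x y * exp (2 * U x y) - 1 + F x y * N x y)).
  pose (Z2 := sin x * d_theta J x y + cos x * J x y + d_phi K x y
    - cos x * (F x y * N x y - J x y)
    - sin x * N x y * ((m2 x y + h2 x y * p x y) * exp (U x y))).
  pose (Z3 := sin x * d_theta K x y + 2 * cos x * K x y
    + (d_phi F x y * N x y + F x y * d_phi N x y - d_phi J x y)
    - N x y * (sin x * (r2 x y + h2 x y * q x y) * exp (U x y))).
  assert (HZ1 : Z1 = 0) by (unfold Z1; rewrite HL; ring).
  assert (HZ2 : Z2 = 0) by (unfold Z2; rewrite T1; ring).
  assert (HZ3 : Z3 = 0) by (unfold Z3; rewrite T2, F_f; ring).
  R_eq; symmetry.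
  transitivity (sin x * ((m1 x y * X1 x y + r1 x y * Y x y) * exp (2 * U x y) / 2
    + (m2 x y * X1 x y + r2 x y * Y x y) * exp (U x y) * N x y)
    + (Z1 * (X1 x y * p x y + Y x y * q x y - X x y) + Z2 * X1 x y + Z3 * Y x y)).
  + unfold Z1, Z2, Z3, V, F; field.
  + rewrite HZ1, HZ2, HZ3; ring.
- smooth2_auto.
- assumption.
- intros x y; apply (smooth2_is_derive_l 1); smooth2_auto.
- intros x y; apply (smooth2_is_derive_r 1); assumption.
- intros y; rewrite sin_0, sin_PI; ring.
- intros x.
  (* Derivatives in [x] inherit the antiperiodicity. In [W] spinor components and their derivatives
     occur only in products of two, so the signs cancel. *)
  assert (At : forall G, List.In G (a1 :: a2 :: b1 :: b2 :: nil)%list ->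
    d_theta G x (2 * PI) = - d_theta G x 0).
  { intros G HG; unfold d_theta; rewrite <- Derive_opp; apply Derive_ext; intros t.
    now apply Anti. }
  unfold W, F, N, J, K, norm2_in, stress11, stress12.
  rewrite (Per X), (Per X1), (Per Y), (Per U), (Per p), (Per q), (Per h1), (Per h2),
    (At a1), (At a2), (At b1), (At b2), (Anti a1), (Anti a2), (Anti b1), (Anti b2)
    by (simpl; tauto).
  field.
Qed.

Theorem proposition1p1 (h1 h2 u : V3 -> R) (psi : V4 -> spinor_space)
  (h1_smooth : smooth_on_sphere h1)
  (h2_smooth : smooth_on_sphere h2)
  (u_smooth : smooth_on_sphere u)
  (psi_smooth : smooth_spinor psi)
  (laplace_eq : forall p : V3, unit_sphere p ->
     - laplace u p
     = h1 p * exp (2 * u p) - 1 + h2 p * exp (u p) * spinor_norm2_at psi p)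
  (dirac_eq : forall g : V4, unit_sphere g ->
     dirac psi g = spinor_scal (h2 (base g) * exp (u (base g))) (psi g)) :
  forall i : nat, (1 <= i <= 3)%nat ->
    sphere_integral
      (fun p => dot (grad h1 p) (grad (coord i) p) * exp (2 * u p))
    + 2 * sphere_integral
        (fun p => dot (grad h2 p) (grad (coord i) p) * exp (u p)
                  * spinor_norm2_at psi p)
    = 0.
Proof.
intros i Hi.
pose proof psi_smooth as (Heq & Sa1 & Sa2 & Sb1 & Sb2).
set (a1 := fun x y => fst (fst (psi (spin_frame x y)))).
set (a2 := fun x y => snd (fst (psi (spin_frame x y)))).
set (b1 := fun x y => fst (snd (psi (spin_frame x y)))).
set (b2 := fun x y => snd (snd (psi (spin_frame x y)))).
set (X := fun x y => coord i (sph x y)).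
set (X1 := fun x y => coord i (e_theta x y)).
set (Y := fun x y => coord i (e_phi x y)).
set (U := fun x y => u (sph x y)).
set (H1 := fun x y => h1 (sph x y)).
set (H2 := fun x y => h2 (sph x y)).
set (p := fun x y => dot (grad u (sph x y)) (e_theta x y)).
set (q := fun x y => dot (grad u (sph x y)) (e_phi x y)).
set (m1 := fun x y => dot (grad h1 (sph x y)) (e_theta x y)).
set (r1 := fun x y => dot (grad h1 (sph x y)) (e_phi x y)).
set (m2 := fun x y => dot (grad h2 (sph x y)) (e_theta x y)).
set (r2 := fun x y => dot (grad h2 (sph x y)) (e_phi x y)).
assert (N_eq : forall x y, spinor_norm2_at psi (sph x y) = norm2_in a1 a2 b1 b2 x y).
{ intros x y; rewrite spinor_norm2_at_sph by assumption.
  unfold spinor_norm2, norm2_in; rewrite !Cmod_sqr; unfold a1, a2, b1, b2; ring. }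
assert (SX : forall k, smooth2 k X /\ smooth2 k X1 /\ smooth2 k Y).
{ intros k; unfold X, X1, Y, sph, e_theta, e_phi.
  destruct i as [|[|[|[|i]]]]; try lia; simpl; refine (conj _ (conj _ _)); smooth2_auto. }
assert (SU : forall k, smooth2 k U) by (intros; now apply smooth2_sph).
assert (Sp : forall k, smooth2 k p) by (intros; now apply smooth2_grad_theta).
assert (Sq : forall k, smooth2 k q) by (intros; now apply smooth2_grad_phi).
assert (Sm1 : forall k, smooth2 k m1) by (intros; now apply smooth2_grad_theta).
assert (Sr1 : forall k, smooth2 k r1) by (intros; now apply smooth2_grad_phi).
assert (Sm2 : forall k, smooth2 k m2) by (intros; now apply smooth2_grad_theta).
assert (Sr2 : forall k, smooth2 k r2) by (intros; now apply smooth2_grad_phi).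
assert (Sa1' : forall k, smooth2 k a1) by (intros; now apply (smooth2_spin_frame k (fun g => fst (fst (psi g))))).
assert (Sa2' : forall k, smooth2 k a2) by (intros; now apply (smooth2_spin_frame k (fun g => snd (fst (psi g))))).
assert (Sb1' : forall k, smooth2 k b1) by (intros; now apply (smooth2_spin_frame k (fun g => fst (snd (psi g))))).
assert (Sb2' : forall k, smooth2 k b2) by (intros; now apply (smooth2_spin_frame k (fun g => snd (snd (psi g))))).
(* [A] carries the factor 1/2 of the chart identity: the first integral of the claim is that of A +
   A, and the whole claim is twice the integral of A + B. *)
set (A := fun x y => sin x * ((m1 x y * X1 x y + r1 x y * Y x y) * exp (2 * U x y) / 2)).
set (B := fun x y => sin x * ((m2 x y * X1 x y + r2 x y * Y x y) * exp (U x y) * norm2_in a1 a2 b1 b2 x y)).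
destruct (SX 1%nat) as (SX_1 & SX1_1 & SY_1).
pose proof (SU 1%nat); pose proof (Sm1 1%nat); pose proof (Sr1 1%nat);
  pose proof (Sm2 1%nat); pose proof (Sr2 1%nat); pose proof (Sa1' 1%nat);
  pose proof (Sa2' 1%nat); pose proof (Sb1' 1%nat); pose proof (Sb2' 1%nat).
assert (SA : smooth2 1 A) by (unfold A; smooth2_auto).
assert (SB : smooth2 1 B) by (unfold B, norm2_in; smooth2_auto).
assert (EA : sphere_integral (fun p => dot (grad h1 p) (grad (coord i) p) * exp (2 * u p))
  = RInt (fun y => RInt (fun x => A x y + A x y) 0 PI) 0 (2 * PI)).
{ apply RInt_ext; intros y _; apply RInt_ext; intros x _; R_eq; fold (sph x y).
  rewrite dot_grad_coord by auto; unfold A, m1, r1, X1, Y, U; field. }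
assert (EB : sphere_integral (fun p => dot (grad h2 p) (grad (coord i) p) * exp (u p) * spinor_norm2_at psi p)
  = RInt (fun y => RInt (fun x => B x y) 0 PI) 0 (2 * PI)).
{ apply RInt_ext; intros y _; apply RInt_ext; intros x _; R_eq; fold (sph x y).
  rewrite dot_grad_coord, N_eq by auto; unfold B, m2, r2, X1, Y, U; ring. }
rewrite EA, EB, RInt2_plus by assumption.
enough (RInt (fun y => RInt (fun x => A x y + B x y) 0 PI) 0 (2 * PI) = 0) as E
  by (rewrite RInt2_plus in E by assumption; lra).
refine (eq_trans _ (kazdan_warner_chart X X1 Y U p q H1 m1 r1 H2 m2 r2 a1 a2 b1 b2
  _ _ _ _ _ _ _ _ _ _ _ _ _ _ _ _ _ _ _ _ _ _ _ _ _ _ _ _ _ _ _)); try apply SX; auto.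
- apply RInt_ext; intros y _; apply RInt_ext; intros x _; R_eq; unfold A, B; ring.
- now apply smooth2_sph.
- now apply smooth2_sph.
- intros x y; apply is_derive_unique; unfold X, X1, sph, e_theta.
  destruct i as [|[|[|[|i]]]]; try lia; simpl; auto_derive; auto; ring.
- intros x y; apply is_derive_unique; unfold X, Y, sph, e_phi.
  destruct i as [|[|[|[|i]]]]; try lia; simpl; auto_derive; auto; ring.
- intros x y; apply is_derive_unique; unfold X, X1, sph, e_theta.
  destruct i as [|[|[|[|i]]]]; try lia; simpl; auto_derive; auto; ring.
- intros x y; apply is_derive_unique; unfold X1, Y, e_phi, e_theta.
  destruct i as [|[|[|[|i]]]]; try lia; simpl; auto_derive; auto; ring.
- intros x y; apply is_derive_unique; unfold Y, e_phi.
  destruct i as [|[|[|[|i]]]]; try lia; simpl; auto_derive; auto; ring.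
- intros x y; apply is_derive_unique; unfold X, X1, Y, sph, e_phi, e_theta.
  destruct i as [|[|[|[|i]]]]; try lia; simpl; auto_derive; auto; trig_ring x y.
- intros x y; now apply is_derive_unique, is_derive_theta.
- intros x y; now apply is_derive_unique, is_derive_phi.
- intros x y; now apply is_derive_unique, is_derive_theta.
- intros x y; now apply is_derive_unique, is_derive_phi.
- intros x y; now apply is_derive_unique, is_derive_theta.
- intros x y; now apply is_derive_unique, is_derive_phi.
- intros x y; pose proof (laplace_spherical u x y u_smooth) as L.
  pose proof (laplace_eq _ (unit_sph x y)) as L'; rewrite N_eq in L'.
  change (sin x * laplace u (sph x y)
    = sin x * d_theta p x y + cos x * p x y + d_phi q x y) in L.
  rewrite <- L, <- (Ropp_involutive (laplace _ _)), L'; unfold H1, H2, U; ring.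
- intros x y; apply (dirac_spherical psi x y (H2 x y * exp (U x y)) psi_smooth).
  rewrite dirac_eq, base_spin_frame by apply unit_spin_frame; reflexivity.
- intros x y; apply (dirac_spherical psi x y (H2 x y * exp (U x y)) psi_smooth).
  rewrite dirac_eq, base_spin_frame by apply unit_spin_frame; reflexivity.
- intros x y; apply (dirac_spherical psi x y (H2 x y * exp (U x y)) psi_smooth).
  rewrite dirac_eq, base_spin_frame by apply unit_spin_frame; reflexivity.
- intros x y; apply (dirac_spherical psi x y (H2 x y * exp (U x y)) psi_smooth).
  rewrite dirac_eq, base_spin_frame by apply unit_spin_frame; reflexivity.
(* The scalar data depend on [y] only through [sph], [e_theta] and [e_phi]. *)
- assert (Es : forall x, sph x (2 * PI) = sph x 0 /\ e_theta x (2 * PI) = e_theta x 0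
    /\ e_phi x (2 * PI) = e_phi x 0).
  { intros x; unfold sph, e_theta, e_phi; now rewrite cos_2PI, sin_2PI, cos_0, sin_0. }
  intros G HG x; destruct (Es x) as (E1 & E2 & E3).
  unfold X, X1, Y, U, p, q, H1, H2 in HG; simpl in HG.
  repeat destruct HG as [<-|HG]; try contradiction; rewrite ?E1, ?E2, ?E3; reflexivity.
- intros G HG x; rewrite <- (Rplus_0_l (2 * PI)).
  unfold a1, a2, b1, b2 in HG; simpl in HG.
  repeat destruct HG as [<-|HG]; try contradiction;
    rewrite spin_frame_2PI by assumption; unfold spinor_scal; cbn; ring.
Qed.
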